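(* Fix $B=0$. For $\tau\in(3,4]$ let $W$ have the Pareto density $f_W(w)=(\tau-1)w^{-\tau}\mathbf{1}_{[1,\infty)}(w)$. Then for every integer $q\ge3$ there exists $\tau(q)\in(3,4]$ such that the function $t\mapsto\frac{d^2}{dt^2}\mathscr{F}_0(t)$ is first positive and then negative when $\tau\in(\tau(q),4]$, while $\frac{d^2}{dt^2}\mathscr{F}_0(t)$ is negative on $(0,\infty)$ when $\tau\in(3,\tau(q)]$. Consequently, for $\tau\in(\tau(q),4]$ the phase transition is first order, while for $\tau\in(3,\tau(q)]$ the phase transition is second order with critical value $\beta_c=\log(1+q/\nu)$, where $\nu=\mathbb{E}[W^2]/\mathbb{E}[W]$. Moreover, $\tau(q)$ satisfies $$\int_0^\infty x^{3-\tau(q)}\,\frac{(q-1)\mathrm{e}^x-\mathrm{e}^{2x}}{(\mathrm{e}^x+q-1)^3}\,dx=0.$$ Finally, as $q\to\infty$, $\tau(q)=3+\frac{\log q}{q}(1+o(1))$.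
   Context: For $t\ge0$, $\mathscr{F}_0(t)=\mathbb{E}\Big[\frac{W}{\mathbb{E}[W]}\,\frac{\mathrm{e}^{tW}-1}{\mathrm{e}^{tW}+q-1}\Big]$. ''First positive and then negative'' means that there is a $t_*>0$ with $\frac{d^2}{dt^2}\mathscr{F}_0(t)>0$ for $0<t<t_*$ and $\frac{d^2}{dt^2}\mathscr{F}_0(t)<0$ for $t>t_*$. Phase transition (zero field): for $\beta>0$, $\beta'=\mathrm{e}^\beta-1$, let $s^\star(\beta,0)$ be the maximizer over $s\in[0,1]$ of $$p_{\beta,0}(s)=\mathbb{E}\big[\log(\mathrm{e}^{\beta'Ws}+q-1)\big]-\frac{\beta'\mathbb{E}[W]}{2q}\big[(q-1)s^2+2s-1\big].$$ The phase transition is first order if there is $\beta_c\in(0,\infty)$ such that the maximizer is unique for $\beta\ne\beta_c$, and $\beta\mapsto s^\star(\beta,0)$ has a jump discontinuity at $\beta_c$ ($s^\star=0$ below $\beta_c$, and $\lim_{\beta\searrow\beta_c}s^\star(\beta,0)>0$). It is second order with critical value $\beta_c$ if the maximizer is unique for every $\beta>0$, $s^\star(\beta,0)=0$ for $\beta\le\beta_c$, $s^\star(\beta,0)>0$ for $\beta>\beta_c$, and $\beta\mapsto s^\star(\beta,0)$ is continuous (in particular at $\beta_c$). *)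

(* Defs.v *)
From HB Require Import structures.
From mathcomp Require Export all_boot all_order all_algebra.
From mathcomp Require Export all_classical all_reals all_analysis.
Export Order.TTheory GRing.Theory Num.Theory.
Export numFieldNormedType.Exports.

Set Implicit Arguments.
Unset Strict Implicit.
Unset Printing Implicit Defensive.

Local Open Scope classical_set_scope.
Local Open Scope ring_scope.

Definition pareto_pdf (R : realType) (tau w : R) : R :=
  (tau - 1) * w `^ (- tau) * \1_(`[1, +oo[ : set R) w.

Definition has_density (R : realType) (d : measure_display)
    (T : measurableType d) (P : probability T R) (W : {RV P >-> R})
    (f : R -> R) : Prop :=
  forall A : set R, measurable A ->
    distribution P W A = (\int[lebesgue_measure]_(w in A) (f w)%:E)%E.

(* [fine] returns 0 on infinite values. Every expectation used below is finite
   as soon as W is almost surely nonnegative, with E[W] > 0 and E[W^2] finite. *)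
Definition expect (R : realType) (d : measure_display) (T : measurableType d)
    (P : probability T R) (X : T -> R) : R :=
  fine ('E_P[X])%E.

Definition nu (R : realType) (d : measure_display) (T : measurableType d)
    (P : probability T R) (W : {RV P >-> R}) : R :=
  expect P (fun x => W x ^+ 2) / expect P W.

(* The defining formula is used for every real t, although F_0 is only needed
   for t >= 0: this makes two-sided derivatives at t > 0 meaningful. *)
Definition F0 (R : realType) (d : measure_display) (T : measurableType d)
    (P : probability T R) (W : {RV P >-> R}) (q : nat) (t : R) : R :=
  expect P (fun x => W x / expect P W
    * ((expR (t * W x) - 1) / (expR (t * W x) + q%:R - 1))).

Definition p0 (R : realType) (d : measure_display) (T : measurableType d)
    (P : probability T R) (W : {RV P >-> R}) (q : nat) (b s : R) : R :=
  let b' := expR b - 1 in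
  expect P (fun x => ln (expR (b' * W x * s) + q%:R - 1))
  - b' * expect P W / (2 * q%:R) * ((q%:R - 1) * s ^+ 2 + 2 * s - 1).

Section Sign.
Variable R : realType.

(* [derive1] is a total operation, so that existence of the derivatives has to be
   required separately. *)
Definition twice_derivable_pos (f : R -> R) : Prop :=
  forall t, 0 < t -> derivable f t 1 /\ derivable (derive1 f) t 1.

Definition first_positive_then_negative (f : R -> R) : Prop :=
  exists ts : R, [/\ 0 < ts,
    forall t, 0 < t -> t < ts -> 0 < f t &
    forall t, ts < t -> f t < 0].

Definition negative_on_pos (f : R -> R) : Prop :=
  forall t, 0 < t -> f t < 0.

End Sign.

(* Here p b s is the function to be maximized over s in [0, 1]. *)
Section PhaseTransition.
Variables (R : realType) (p : R -> R -> R).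

Definition maximizers (b : R) : set R :=
  [set s | s \in `[0, 1] /\ forall u, u \in `[0, 1] -> p b u <= p b s].

Definition unique_maximizer (b : R) : Prop := exists! s, maximizers b s.

(* The maximizer when it is unique; some maximizer when there are several. *)
Definition sstar (b : R) : R := xget 0 (maximizers b).

Definition first_order : Prop :=
  exists bc : R, [/\ 0 < bc,
    forall b, 0 < b -> b != bc -> unique_maximizer b,
    forall b, 0 < b -> b < bc -> sstar b = 0 &
    exists2 l : R, 0 < l & sstar b @[b --> bc^'+] --> l].

Definition second_order (bc : R) : Prop :=
  [/\ forall b, 0 < b -> unique_maximizer b,
      forall b, 0 < b -> b <= bc -> sstar b = 0,
      forall b, 0 < b -> bc < b -> 0 < sstar b &
      {in `]0, +oo[, continuous sstar}].

End PhaseTransition.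

(* Main.v *)
From HB Require Import structures.
Require Import Defs.
From mathcomp Require Import ring lra measurable_realfun.

(* Write [c = q - 1], [L = ln c] and let [h = resp2 c] be the second derivative
   of [(e^y - 1) / (e^y + c)], which is positive before [L] and negative after.
   For a Pareto weight, differentiating twice under the expectation and
   rescaling shows that [F_0''(t)] is a positive multiple of
   [int_t^oo x^(3 - tau) h(x) dx], whose sign on [(0, oo)] only depends on
   whether the integral over the whole half line is positive.  After
   normalizing the power to [(x / L)^(3 - tau)], the integrand is pointwise
   nondecreasing in [tau], so there is one critical [tau(q)], where that integral
   vanishes.

   For the phase transition, [p] is up to an affine change of variables
   [Phi(t) - t^2 / (2 b)] with [Phi' = F_0] and [b = e^beta - 1].  Its positive
   maximizers solve [F_0(t) / t = 1 / b] and satisfy [2 Phi(t) / t^2 > 1 / b];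
   the shape of [F_0] makes these two ratios unimodal, and they cross at the
   maximum of the second one.

   For the asymptotics, with [d = tau(q) - 3], the equation reads
   [int_0^oo ((x / L)^(-d) - 1) h(x) dx = 1 / q], since the integral of [h] is
   [- 1 / q].  The integrand is nonnegative and equals
   [- (d / L) (x - L) h(x)] up to terms of relative order [1 / L], and
   the first moment of [h] around [L] is [- (1 - L / q)]; hence [d ~ L / q]. *)

Set Implicit Arguments.
Unset Strict Implicit.
Unset Printing Implicit Defensive.

Local Open Scope classical_set_scope.
Local Open Scope ring_scope.

(** * Calculus on the real line *)

Section Calculus.
Variable R : realType.
Implicit Types (f g : R -> R) (a b x y : R).

(** The range [3 < tau <= 4] is the one where [W] has a second but no third moment. Differentiating
    twice under the expectation therefore needs [t > 0], where the exponential decay of [h] replaces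
    the missing moment, and signs are read on tails [[t, +oo)]. With [d = tau - 3], the integral
    over the whole half line converges only for [d < 1], because [h(0) > 0]. The end point [tau = 4]
    is [d = 1], so the positive case compares tails at [d] with tails at the critical exponent and
    never integrates down to [0]. The critical [d] exists in [(0, 1)] by continuity: the integral is
    negative at [d = 0] and bounded below by a multiple of [1 / (1 - d)] minus a constant.

    In the asymptotics, the first-order term in [d] carries [ln (x / L)], whose integral against [h]
    is not explicit. Replacing it by [x / L - 1] gives an explicit first moment, at the cost of a
    second moment of [h] around [L]. That moment is bounded uniformly in [c], since [|h|] decays
    exponentially away from [L]. The singularity of the weight at [0] disturbs the upper bound only,
    where the smallness of [h] left of [L / 4] compensates it. *)

Lemma is_derive_fun_cst (k x : R) : is_derive x 1 (fun=> k) 0.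
Proof. exact: is_derive_cst. Qed.

Lemma is_derive_fun_id x : is_derive x 1 (fun y : R => y) 1.
Proof. exact: is_derive_id. Qed.

Lemma is_derive_funD f g x df dg : is_derive x 1 f df -> is_derive x 1 g dg ->
  is_derive x 1 (fun y => f y + g y) (df + dg).
Proof. by move=> ? ?; exact: is_deriveD. Qed.

Lemma is_derive_funB f g x df dg : is_derive x 1 f df -> is_derive x 1 g dg ->
  is_derive x 1 (fun y => f y - g y) (df - dg).
Proof. by move=> ? ?; exact: is_deriveB. Qed.

Lemma is_derive_funN f x df : is_derive x 1 f df ->
  is_derive x 1 (fun y => - f y) (- df).
Proof. by move=> ?; exact: is_deriveN. Qed.

Lemma is_derive_funM f g x df dg : is_derive x 1 f df -> is_derive x 1 g dg ->
  is_derive x 1 (fun y => f y * g y) (df * g x + f x * dg).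
Proof.
move=> hf hg; apply: (is_derive_eq (is_deriveM hf hg)).
by rewrite /GRing.scale /=; ring.
Qed.

Lemma is_derive_funV f x df : f x != 0 -> is_derive x 1 f df ->
  is_derive x 1 (fun y => (f y)^-1) (- df / f x ^+ 2).
Proof.
move=> fx0 hf; apply: (is_derive_eq (is_deriveV fx0 hf)).
rewrite /GRing.scale /= -exprVn; ring.
Qed.

Lemma is_derive_fun_comp f g x df dg : is_derive x 1 g dg ->
  is_derive (g x) 1 f df -> is_derive x 1 (fun y => f (g y)) (df * dg).
Proof.
move=> hg hf; apply: DeriveDef.
  apply/derivable1_diffP; apply: differentiable_comp.
    by apply/derivable1_diffP; case: hg.
  by apply/derivable1_diffP; case: hf.
rewrite -derive1E (@derive1_comp _ g f); [|by case: hg|by case: hf].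
by rewrite !derive1E !derive_val.
Qed.

Lemma is_derive_funV_pos f x df : 0 < f x -> is_derive x 1 f df ->
  is_derive x 1 (fun y => (f y)^-1) (- df / f x ^+ 2).
Proof. by move=> fx; apply: is_derive_funV; rewrite gt_eqF. Qed.

Lemma is_derive_continuous f x df : is_derive x 1 f df -> {for x, continuous f}.
Proof.
by move=> h; apply: differentiable_continuous; apply/derivable1_diffP; case: h.
Qed.

Lemma within_continuous_derive f df a b :
  (forall x, a <= x -> x <= b -> is_derive x 1 f (df x)) ->
  {within `[a, b], continuous f}.
Proof.
move=> h; apply: derivable_within_continuous => x; rewrite in_itv/= => /andP[? ?].
by have [] := h x.
Qed.

Lemma is_derive_MVT f df a b : a < b ->
  (forall x, a <= x -> x <= b -> is_derive x 1 f (df x)) ->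
  exists c, [/\ a < c, c < b & f b - f a = df c * (b - a)].
Proof.
move=> ab h; have [||c] := @MVT _ f df a b ab.
- by move=> x; rewrite in_itv/= => /andP[/ltW ? /ltW ?]; exact: h.
- exact: within_continuous_derive h.
by rewrite in_itv/= => /andP[? ?] ?; exists c.
Qed.

Lemma is_derive_gt0_lt f df a b : a < b ->
  (forall x, a <= x -> x <= b -> is_derive x 1 f (df x)) ->
  (forall x, a < x -> x < b -> 0 < df x) -> f a < f b.
Proof.
move=> ab h h0; have [c [ac cb e]] := is_derive_MVT ab h.
by rewrite -subr_gt0 e mulr_gt0 ?h0// subr_gt0.
Qed.

Lemma is_derive_lt0_lt f df a b : a < b ->
  (forall x, a <= x -> x <= b -> is_derive x 1 f (df x)) ->
  (forall x, a < x -> x < b -> df x < 0) -> f b < f a.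
Proof.
move=> ab h h0; have [c [ac cb e]] := is_derive_MVT ab h.
by rewrite -subr_gt0 -opprB e -mulNr mulr_gt0 ?oppr_gt0 ?h0// subr_gt0.
Qed.

Lemma is_derive_IVT0 f df a b : a <= b ->
  (forall x, a <= x -> x <= b -> is_derive x 1 f (df x)) ->
  0 <= f a -> f b <= 0 -> exists c, [/\ a <= c, c <= b & f c = 0].
Proof.
move=> ab h fa fb; have [|c] := @IVT _ f a b 0 ab (within_continuous_derive h).
  by rewrite ge_min le_max fa fb orbT.
by rewrite in_itv/= => /andP[? ?] ?; exists c.
Qed.

(** Transfers a sign pattern from a derivative to its primitive: positivity is given up to [ts],
    strict decrease holds after it, and [t'] certifies that the function does come down. It serves
    twice in the first-order case, for [t F' - F] and then for [t F - 2 Phi]. *)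
Lemma single_sign_change f df ts t' : 0 < ts -> ts <= t' ->
  (forall x, 0 < x -> is_derive x 1 f (df x)) ->
  (forall x, 0 < x -> x < ts -> 0 < f x) ->
  (forall x, ts < x -> df x < 0) -> f t' <= 0 ->
  exists t1, [/\ ts <= t1, f t1 = 0,
    forall x, 0 < x -> x < t1 -> 0 < f x & forall x, t1 < x -> f x < 0].
Proof.
move=> ts0 tst' df_ fpos dfneg ft'.
have decr x y : ts <= x -> x < y -> f y < f x.
  move=> tsx xy; have x0 := lt_le_trans ts0 tsx.
  apply: (@is_derive_lt0_lt f df) => // [z xz zy|z xz zy].
    by apply: df_; exact: lt_le_trans xz.
  by apply: dfneg; exact: le_lt_trans xz.
have [t1 [at1 t1t' ft1]] : exists c, [/\ ts / 2 <= c, c <= t' & f c = 0].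
  apply: (@is_derive_IVT0 f df) => //; [lra| |apply/ltW/fpos; lra].
  by move=> x ax _; apply: df_; lra.
have t10 : 0 < t1 by lra.
have tst1 : ts <= t1.
  by rewrite leNgt; apply/negP => /(fpos _ t10); rewrite ft1 ltxx.
exists t1; split => // [x x0 xt1|x t1x].
  have [xts|tsx] := ltP x ts; first exact: fpos.
  by rewrite -ft1; exact: decr.
by rewrite -ft1; exact: decr.
Qed.

End Calculus.

(** * Maximizers and phase transitions *)

Section Maximization.
Variables (R : realType) (p : R -> R -> R) (F Phi C0 C1 : R -> R) (tc rc : R).
Hypothesis dPhi : forall t : R, is_derive t 1 Phi (F t).
Hypothesis Phi0 : Phi 0 = 0.
Hypothesis F_lt1 : forall t : R, 0 < t -> F t < 1.
Hypothesis C1_gt0 : forall b : R, 0 < b -> 0 < C1 b.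
Hypothesis pE : forall b s : R,
  p b s = C0 b + C1 b * (Phi ((expR b - 1) * s) - (expR b - 1) * s ^+ 2 / 2).
Hypothesis rc_gt0 : 0 < rc.
Hypothesis ratio_decr : forall x y : R, tc < x -> x < y -> F y / y < F x / x.
Hypothesis ratio_lt : forall y : R, tc < y -> F y / y < rc.
Hypothesis Phi_lt : forall t : R, 0 < t -> t != tc -> 2 * Phi t < rc * t ^+ 2.
Hypothesis Phi_tc : 2 * Phi tc <= rc * tc ^+ 2.
Hypothesis Phi_gt : forall t : R, 0 < t -> t * F t < 2 * Phi t -> tc < t.
Hypothesis Phi_rc : forall r : R, r < rc -> exists2 t : R, 0 < t & r * t ^+ 2 < 2 * Phi t.

Let bt (b : R) : R := expR b - 1.
Let bc : R := ln (1 + rc^-1).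

Let bt_gt0 (b : R) : 0 < b -> 0 < bt b.
Proof. by move=> b0; rewrite /bt subr_gt0 expR_gt1. Qed.

Let bt_bc : bt bc = rc^-1.
Proof.
rewrite /bt /bc lnK ?posrE; last by rewrite addr_gt0// invr_gt0.
by rewrite addrAC subrr add0r.
Qed.

Lemma critical_gt0 : 0 < bc.
Proof. by apply: ln_gt0; rewrite ltrDl invr_gt0. Qed.

Let bt_lt (b1 b2 : R) : (bt b1 < bt b2) = (b1 < b2).
Proof. by rewrite /bt ltrD2r ltr_expR. Qed.

Let lt_bc (b : R) : 0 < b -> (b < bc) = (rc < (bt b)^-1).
Proof.
move=> b0; rewrite -(bt_lt b bc) bt_bc -[rc in RHS]invrK ltf_pV2 ?posrE//.
  by rewrite invr_gt0.
exact: bt_gt0.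
Qed.

Let gt_bc (b : R) : 0 < b -> (bc < b) = ((bt b)^-1 < rc).
Proof.
move=> b0; rewrite -(bt_lt bc b) bt_bc -[rc in RHS]invrK ltf_pV2 ?posrE//.
  exact: bt_gt0.
by rewrite invr_gt0.
Qed.

Let psi (b s : R) := Phi (bt b * s) - bt b * s ^+ 2 / 2.

Let p_le (b s u : R) : 0 < b -> (p b s <= p b u) = (psi b s <= psi b u).
Proof. by move=> b0; rewrite !pE lerD2l ler_pM2l// C1_gt0. Qed.

Let psi0 (b : R) : psi b 0 = 0.
Proof. by rewrite /psi mulr0 Phi0 expr2 !mulr0 mul0r subrr. Qed.

Let dpsi (b s : R) : is_derive s 1 (psi b) (bt b * (F (bt b * s) - s)).
Proof.
have h1 : is_derive s 1 (fun y => bt b * y) (0 * s + bt b * 1).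
  exact: is_derive_funM (is_derive_fun_cst _ _) (is_derive_fun_id _).
have h2 := is_derive_fun_comp h1 (dPhi (bt b * s)).
have h3 : is_derive s 1 (fun y => bt b * (y * y) / 2) _ :=
  is_derive_funM (is_derive_funM (is_derive_fun_cst (bt b) s)
   (is_derive_funM (is_derive_fun_id s) (is_derive_fun_id s)))
   (is_derive_fun_cst 2^-1 s).
apply: (is_derive_eq (is_derive_funB h2 h3)). by field.
Qed.

(** [rc] plays the role of the supremum of [2 Phi t / t ^ 2], and [tc] of the point where it is
    attained, or [0] when it is only approached there. With [t = bt b * s], [psi b s < 0] means
    [2 Phi t / t ^ 2 < 1 / bt b]. Below [bc] the right side exceeds [rc]; at [bc] it equals [rc],
    and [Phi_lt] is strict at every [t > 0] once [tc = 0]. *)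
Lemma maximizer0 (b : R) : 0 < b -> b < bc \/ b = bc /\ tc = 0 ->
  unique (maximizers p b) 0.
Proof.
move=> b0 hb.
have psi_lt s : 0 < s -> psi b s < 0.
  move=> s0; have t0 := mulr_gt0 (bt_gt0 b0) s0.
  suff h : 2 * Phi (bt b * s) < (bt b)^-1 * (bt b * s) ^+ 2.
    rewrite /psi; move: h; rewrite (_ : _^-1 * _ = bt b * s ^+ 2); first lra.
    by field; rewrite gt_eqF// bt_gt0.
  case: hb => [bbc|[bbc tc0]].
    have rcb : rc < (bt b)^-1 by rewrite -lt_bc.
    apply: (@le_lt_trans _ _ (rc * (bt b * s) ^+ 2)).
      by have [->|] := eqVneq (bt b * s) tc => // /(Phi_lt t0) /ltW.
    by rewrite ltr_pM2r// exprn_gt0.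
  rewrite bbc bt_bc invrK -bt_bc -bbc; apply: Phi_lt => //.
  by rewrite tc0 gt_eqF.
split=> [|s [s01 smax]]; last first.
  have /smax : (0 : R) \in `[0, 1] by rewrite in_itv/= lexx ler01.
  rewrite p_le// psi0; move: s01; rewrite in_itv/= => /andP[s0 _].
  move: s0; rewrite le_eqVlt => /predU1P[//|/psi_lt]; lra.
split=> [|u]; first by rewrite in_itv/= lexx ler01.
rewrite in_itv/= p_le// psi0 => /andP[u0 _].
move: u0; rewrite le_eqVlt => /predU1P[<-|/psi_lt/ltW//].
by rewrite psi0.
Qed.

(** As [F < 1], a maximizer over [[0, 1]] is a maximizer over [[0, +oo)], so that the end point [1]
    needs no separate treatment. *)
Let psi_decr (b s : R) : 0 < b -> 1 < s -> psi b s < psi b 1.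
Proof.
move=> b0 s1; apply: (is_derive_lt0_lt s1 (fun x _ _ => dpsi b x)) => x x1 _.
have bb := bt_gt0 b0; rewrite pmulr_rlt0// subr_lt0.
apply: (lt_trans _ x1); apply: F_lt1; apply: mulr_gt0 => //; lra.
Qed.

(** Above [bc] the function [psi b] takes a positive value, hence [psi b s > 0] at a maximizer. With
    [t = bt b * s] and the critical equation [F t = s], this reads [t * F t < 2 * Phi t] and places
    [t] beyond [tc], where [F t / t] is strictly decreasing. Since that ratio is [1 / bt b],
    uniqueness follows. *)
Let maximizer_crit (b s : R) : 0 < b -> bc < b -> maximizers p b s ->
  [/\ 0 < s, tc < bt b * s & F (bt b * s) / (bt b * s) = (bt b)^-1].
Proof.
move=> b0 bcb [s01 smax]; have bb := bt_gt0 b0.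
(* The test point [t / bt b] may lie outside [[0, 1]], which is why [smax2] extends maximality to
   all [u >= 0]. *)
have [t t0 ht] : exists2 t : R, 0 < t & (bt b)^-1 * t ^+ 2 < 2 * Phi t.
  by apply: Phi_rc; rewrite -gt_bc.
have psit : 0 < psi b (t / bt b).
  rewrite /psi mulrCA mulfV ?gt_eqF// mulr1.
  have -> : bt b * (t / bt b) ^+ 2 = (bt b)^-1 * t ^+ 2.
    by field; rewrite gt_eqF.
  lra.
have smax2 u : 0 <= u -> psi b u <= psi b s.
  move=> u0; have [u1|u1] := leP u 1.
    by rewrite -p_le//; apply: smax; rewrite in_itv/= u0.
  apply: le_trans (ltW (psi_decr b0 u1)) _.
  by rewrite -p_le//; apply: smax; rewrite in_itv/= lexx ler01.
have psis : 0 < psi b s by apply: lt_le_trans psit (smax2 _ _); rewrite divr_ge0// ltW.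
have s0 : 0 < s.
  move: s01; rewrite in_itv/= le_eqVlt => /andP[/predU1P[s0|//] _].
  by move: psis; rewrite -s0 psi0 ltxx.
(* The open interval []0, 2[] contains [1], so the derivative vanishes even if [s] is the right end
   point. *)
have /(@derive_val _ _ _ _ _ _ _) d0 : is_derive s 1 (psi b) 0.
  apply: (@derive1_at_max _ _ 0 2).
  - lra.
  - by move=> x _; have [] := dpsi b x.
  - by move: s01; rewrite !in_itv/= => /andP[_ ?]; rewrite s0/=; lra.
  - by move=> x; rewrite in_itv/= => /andP[/ltW x0 _]; exact: smax2.
have := dpsi b s; move/(@derive_val _ _ _ _ _ _ _); rewrite d0 => /esym/eqP.
rewrite mulf_eq0 gt_eqF//= subr_eq0 => /eqP Fs.
have ts0 : 0 < bt b * s by exact: mulr_gt0.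
split => //; last by rewrite Fs; field; rewrite !gt_eqF.
apply: Phi_gt => //; rewrite Fs; move: psis; rewrite /psi.
rewrite (_ : bt b * s * s = bt b * s ^+ 2); first lra.
by rewrite expr2 mulrA.
Qed.

Lemma maximizer_pos (b : R) : 0 < b -> bc < b -> unique_maximizer p b.
Proof.
move=> b0 bcb.
have [s s01 smax] : exists2 s, s \in `[0, 1] &
    forall t : R, t \in `[0, 1] -> psi b t <= psi b s.
  apply: EVT_max; first exact: ler01.
  by apply: within_continuous_derive => x _ _; exact: dpsi.
have ms : maximizers p b s by split=> // u u01; rewrite p_le//; exact: smax.
exists s; split=> // s' ms'.
have [_ ts es] := maximizer_crit b0 bcb ms.
have [_ ts' es'] := maximizer_crit b0 bcb ms'.
have bb := bt_gt0 b0.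
apply: (mulfI (lt0r_neq0 bb)).
have [lt_ss'|lt_s's|//] := ltgtP (bt b * s) (bt b * s').
- by have := ratio_decr ts lt_ss'; rewrite es es' ltxx.
- by have := ratio_decr ts' lt_s's; rewrite es es' ltxx.
Qed.

Let sstarP (b : R) : unique_maximizer p b -> maximizers p b (sstar p b).
Proof. by move=> [s [ms _]]; apply: xgetPex; exists s. Qed.

Lemma sstar_eq0 (b : R) : 0 < b -> b < bc \/ b = bc /\ tc = 0 -> sstar p b = 0.
Proof.
move=> b0 hb; have [m0 u0] := maximizer0 b0 hb.
by rewrite -(u0 (sstar p b))//; apply: sstarP; exists 0.
Qed.

Let sstar_crit (b : R) : 0 < b -> bc < b -> [/\ 0 < sstar p b, tc < bt b * sstar p b &
  F (bt b * sstar p b) / (bt b * sstar p b) = (bt b)^-1].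
Proof.
by move=> b0 bcb; apply: maximizer_crit => //; exact/sstarP/maximizer_pos.
Qed.

Let continuous_bt (b : R) : {for b, continuous bt}.
Proof.
by apply: (@is_derive_continuous _ _ _ (expR b - 0));
  exact: is_derive_funB (is_derive_expR b) (is_derive_fun_cst _ _).
Qed.

Let continuous_btV (b : R) : 0 < b -> {for b, continuous (fun x => (bt x)^-1)}.
Proof.
move=> b0; apply: continuousV; last exact: continuous_bt.
by rewrite gt_eqF// bt_gt0.
Qed.

Let T (b : R) := bt b * sstar p b.

(** [T b] solves [F y / y = 1 / bt b] on the decreasing branch [y > tc]. A strict inequality between
    the two sides at the fixed point [T0 + e] persists for [b] near [b0] and locates [T b]. The
    bound [T0] is [tc] at or below the critical value and [T b0] above it. *)
Let T_lt (b0 T0 e : R) : 0 < b0 -> tc <= T0 -> 0 < e ->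
  (forall y : R, T0 < y -> F y / y < (bt b0)^-1) ->
  \forall b \near b0, bc < b -> T b < T0 + e.
Proof.
move=> b00 tcT e0 hR.
have hy : F (T0 + e) / (T0 + e) < (bt b0)^-1 by apply: hR; rewrite ltrDl.
have tce : tc < T0 + e by apply: le_lt_trans tcT _; rewrite ltrDl.
near=> b => bcb.
have b_gt0 : 0 < b by near: b; exact: lt_nbhsr.
have hb : F (T0 + e) / (T0 + e) < (bt b)^-1.
  by near: b; exact: cvgr_gt (continuous_btV b00) _ hy.
have [_ _ eT] := sstar_crit b_gt0 bcb.
rewrite ltNge le_eqVlt; apply/negP => /predU1P[eq_T|lt_T].
  by move: eT hb; rewrite -/(T b) -eq_T => ->; rewrite ltxx.
by have := ratio_decr tce lt_T; rewrite eT => /lt_trans/(_ hb); rewrite ltxx.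
Unshelve. all: by end_near. Qed.

Let T_gt (b0 y : R) : 0 < b0 -> tc < y -> (bt b0)^-1 < F y / y ->
  \forall b \near b0, bc < b -> y < T b.
Proof.
move=> b00 tcy hy.
near=> b => bcb.
have b_gt0 : 0 < b by near: b; exact: lt_nbhsr.
have hb : (bt b)^-1 < F y / y.
  by near: b; exact: cvgr_lt (continuous_btV b00) _ hy.
have [_ tcT eT] := sstar_crit b_gt0 bcb.
rewrite ltNge le_eqVlt; apply/negP => /predU1P[eq_T|lt_T].
  by move: eT hb; rewrite -/(T b) eq_T => ->; rewrite ltxx.
by have := ratio_decr tcT lt_T; rewrite eT => /lt_trans/(_ hb); rewrite ltxx.
Unshelve. all: by end_near. Qed.

Let sstarE (b : R) : 0 < b -> sstar p b = T b * (bt b)^-1.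
Proof. by move=> b0; rewrite /T mulrAC mulfV ?mul1r// gt_eqF// bt_gt0. Qed.

Lemma first_order_criterion : 0 < tc -> first_order p.
Proof.
move=> tc0; exists bc; split; first exact: critical_gt0.
- move=> b b0; rewrite neq_lt => /orP[bbc|]; last exact: maximizer_pos.
  by exists 0; apply: maximizer0 => //; left.
- by move=> b b0 bbc; apply: sstar_eq0 => //; left.
(* The right limit of [T] at [bc] is [tc]: [sstar_crit] bounds [T] below by [tc], and [T_lt] with
   [ratio_lt] bounds it above. *)
exists (tc * (bt bc)^-1); first by rewrite mulr_gt0// bt_bc invrK.
have cT : T b @[b --> bc^'+] --> tc.
  apply/cvgrPdist_lt => e e0.
  have := T_lt critical_gt0 (lexx tc) e0.
  rewrite bt_bc invrK => /(_ ratio_lt) hT.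
  near=> b.
  have bcb : bc < b by near: b; exact: nbhs_right_gt.
  have [_ tcT _] := sstar_crit (lt_trans critical_gt0 bcb) bcb.
  rewrite ltr_distlC -/(T b); apply/andP; split; first by rewrite /T; lra.
  by move: bcb; near: b; exact: cvg_within.
have cbt : (bt b)^-1 @[b --> bc^'+] --> (bt bc)^-1.
  exact/cvg_at_right_filter/continuous_btV/critical_gt0.
apply: cvg_trans (cvgM cT cbt); apply: near_eq_cvg.
near=> b; rewrite /= -sstarE//; apply: (lt_trans critical_gt0).
by near: b; exact: nbhs_right_gt.
Unshelve. all: by end_near. Qed.

Lemma second_order_criterion : tc = 0 -> second_order p bc.
Proof.
move=> tc0; split.
- move=> b b0; have [bcb|] := ltP bc b; first exact: maximizer_pos.
  rewrite le_eqVlt => /predU1P[bE|bbc]; exists 0; apply: maximizer0 => //.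
  + by right.
  + by left.
- move=> b b0; rewrite le_eqVlt => /predU1P[bE|bbc]; apply: sstar_eq0 => //.
  + by right.
  + by left.
- by move=> b b0 bcb; have [] := sstar_crit b0 bcb.
move=> b0; rewrite in_itv/= andbT => b00.
have b_pos : \forall b \near b0, 0 < b by exact: lt_nbhsr.
have T0 (b : R) : 0 < b -> b <= bc -> T b = 0.
  move=> b_gt0 bbc; rewrite /T sstar_eq0 ?mulr0//.
  by move: bbc; rewrite le_eqVlt => /predU1P[|]; [right|left].
have cT : T b @[b --> b0] --> T b0.
  (* The first case includes [b0 = bc]: there [T] vanishes on the left and [T_lt] makes it small on
     the right. *)
  have [b0bc|bcb0] := leP b0 bc.
    rewrite (T0 _ b00 b0bc); apply/cvgrPdist_lt => e e0.
    have /T_lt : 0 < b0 by []. move=> /(_ tc e (lexx _) e0).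
    have hR (y : R) : tc < y -> F y / y < (bt b0)^-1.
      move=> tcy; apply: lt_le_trans (ratio_lt tcy) _.
      rewrite -[rc]invrK -bt_bc lef_pV2 ?posrE ?bt_gt0 ?critical_gt0//.
      by rewrite leNgt bt_lt -leNgt.
    move=> /(_ hR); apply: filterS2 b_pos => b b_gt0 hb.
    rewrite sub0r normrN; have [bbc|bcb] := leP b bc.
      by rewrite T0// normr0.
    have [_ tcT _] := sstar_crit b_gt0 bcb.
    have := hb bcb; rewrite tc0 add0r => ?.
    by rewrite gtr0_norm//; rewrite -tc0.
  have [_ tcT eT] := sstar_crit b00 bcb0.
  apply/cvgrPdist_lt => e e0.
  have h1 : \forall b \near b0, bc < b -> T b < T b0 + e.
    apply: T_lt => //; first exact: ltW.
    by move=> y Ty; rewrite -eT; apply: ratio_decr.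
  (* The maximum keeps [y] strictly between [tc] and [T b0], where [ratio_decr] applies, even when
     [e] is large. *)
  pose y := Num.max ((tc + T b0) / 2) (T b0 - e).
  have tcy : tc < y by rewrite /y lt_max; apply/orP; left; move: tcT; rewrite -/(T b0); lra.
  have yT : y < T b0 by rewrite /y gt_max; apply/andP; split; move: tcT; rewrite -/(T b0); lra.
  have h2 : \forall b \near b0, bc < b -> y < T b.
    by apply: T_gt => //; rewrite -eT; apply: ratio_decr.
  have h3 : \forall b \near b0, bc < b by exact: lt_nbhsr.
  apply: filterS3 h1 h2 h3 => b h1 h2 bcb.
  rewrite ltr_distlC (h1 bcb) andbT.
  by apply: le_lt_trans (h2 bcb); rewrite /y le_max lexx orbT.
rewrite /continuous_at sstarE//.
apply: cvg_trans (cvgM cT (continuous_btV b00)); apply: near_eq_cvg.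
by apply: filterS b_pos => b b_gt0 /=; rewrite -sstarE.
Unshelve. all: by end_near. Qed.

End Maximization.

(** * From the sign of the second derivative of [F] to the order of the transition *)

Section PhaseTransitionCriteria.
Variables (R : realType) (p : R -> R -> R) (F dF ddF Phi C0 C1 : R -> R).
Hypothesis dPhi : forall t : R, is_derive t 1 Phi (F t).
Hypothesis dF_ : forall t : R, is_derive t 1 F (dF t).
Hypothesis ddF_ : forall t : R, 0 < t -> is_derive t 1 dF (ddF t).
Hypothesis Phi0 : Phi 0 = 0.
Hypothesis F0 : F 0 = 0.
Hypothesis F_gt0 : forall t : R, 0 < t -> 0 < F t.
Hypothesis F_lt1 : forall t : R, 0 < t -> F t < 1.
Hypothesis C1_gt0 : forall b : R, 0 < b -> 0 < C1 b.
Hypothesis pE : forall b s : R,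
  p b s = C0 b + C1 b * (Phi ((expR b - 1) * s) - (expR b - 1) * s ^+ 2 / 2).

(** Put [V = t F' - F] and [U = t F - 2 Phi]. Then [V' = t F''], [U' = V], the sign of [V] is that
    of [(F / t)'] and the sign of [U] is that of [(2 Phi / t ^ 2)']. The sign pattern of [F''] thus
    climbs to both ratios. *)
Let dratio (t : R) : 0 < t ->
  is_derive t 1 (fun x => F x / x) ((t * dF t - F t) / t ^+ 2).
Proof.
move=> t0; have h := is_derive_funM (dF_ t)
  (is_derive_funV_pos t0 (is_derive_fun_id t)).
by apply: (is_derive_eq h); field; rewrite gt_eqF.
Qed.

Let dV (t : R) : 0 < t -> is_derive t 1 (fun x => x * dF x - F x) (t * ddF t).
Proof.
move=> t0; have h := is_derive_funB
  (is_derive_funM (is_derive_fun_id t) (ddF_ t0)) (dF_ t).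
by apply: (is_derive_eq h); ring.
Qed.

Let dU (t : R) : is_derive t 1 (fun x => x * F x - 2 * Phi x) (t * dF t - F t).
Proof.
have h := is_derive_funB (is_derive_funM (is_derive_fun_id t) (dF_ t))
  (is_derive_funM (is_derive_fun_cst 2 t) (dPhi t)).
by apply: (is_derive_eq h); ring.
Qed.

Let dM (t : R) : 0 < t -> is_derive t 1 (fun x => 2 * Phi x / (x * x))
  (2 * (t * F t - 2 * Phi t) / t ^+ 3).
Proof.
move=> t0; have tt0 : 0 < t * t by rewrite mulr_gt0.
have h := is_derive_funM (is_derive_funM (is_derive_fun_cst 2 t) (dPhi t))
  (@is_derive_funV_pos _ (fun x => x * x) _ _ tt0 (is_derive_funM (is_derive_fun_id t) (is_derive_fun_id t))).
by apply: (is_derive_eq h); field; rewrite gt_eqF.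
Qed.

Let dF_cst_MVT (t : R) : 0 < t -> exists c, [/\ 0 < c, c < t & F t = t * dF c].
Proof.
move=> t0; have [c [c0 ct]] := is_derive_MVT t0 (fun x _ _ => dF_ x).
by rewrite F0 !subr0 mulrC => e; exists c.
Qed.

Let Phi_le (t : R) : 0 < t -> Phi t <= t.
Proof.
move=> t0; have [c [c0 ct]] := is_derive_MVT t0 (fun x _ _ => dPhi x).
rewrite Phi0 !subr0 => ->; rewrite -[leRHS]mul1r ler_pM2r//.
exact/ltW/F_lt1.
Qed.

Let ratio_decr_lt (a x y : R) : 0 <= a -> (forall z, a < z -> z * dF z - F z < 0) ->
  a < x -> x < y -> F y / y < F x / x.
Proof.
move=> a0 hV ax xy; have x0 := le_lt_trans a0 ax.
apply: (@is_derive_lt0_lt _ (fun x => F x / x) _ _ _ xy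
  (fun z xz _ => dratio (lt_le_trans x0 xz))) => z xz _.
have z0 := lt_trans x0 xz.
by rewrite pmulr_llt0 ?invr_gt0 ?exprn_gt0//; apply: hV; exact: lt_trans xz.
Qed.

(** The case [tc = 0], [rc = dF 0]. As [ddF] is given for [t > 0] only, continuity of [dF] at [0] is
    not at hand; the behaviour near [0] is read from the difference quotient [F x / x], which tends
    to [dF 0] because [F 0 = 0]. *)
Lemma concave_second_order : 0 < dF 0 -> (forall t : R, 0 < t -> ddF t < 0) ->
  second_order p (ln (1 + (dF 0)^-1)).
Proof.
move=> dF0 ddF_lt0.
have dF_decr (x y : R) : 0 < x -> x < y -> dF y < dF x.
  move=> x0 xy; apply: (is_derive_lt0_lt xy
    (fun z xz _ => ddF_ (lt_le_trans x0 xz))) => z xz _.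
  exact/ddF_lt0/(lt_trans x0).
have V_lt0 (t : R) : 0 < t -> t * dF t - F t < 0.
  move=> t0; have [c [c0 ct ->]] := dF_cst_MVT t0.
  by rewrite -mulrBr pmulr_rlt0// subr_lt0 dF_decr.
have cvF : (F x / x) @[x --> 0^'+] --> dF 0.
  have [+ <-] := dF_ 0; move=> /cvg_ex [l hl].
  have -> : 'D_1 F 0 = l by apply/cvg_lim.
  apply: cvg_trans (cvg_dnbhs_at_right hl); apply: near_eq_cvg.
  by near=> x => /=; rewrite scaler1 addr0 F0 subr0 /GRing.scale /= mulrC.
have F_lt (t : R) : 0 < t -> F t < dF 0 * t.
  move=> t0; rewrite -ltr_pdivrMr//.
  apply: (@lt_le_trans _ _ (F (t / 2) / (t / 2))).
    by apply: (ratio_decr_lt (lexx 0) V_lt0); lra.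
  rewrite leNgt; apply/negP => h.
  near (0:R)^'+ => x.
  have x0 : 0 < x by near: x; exact: nbhs_right_gt.
  have xt : x < t / 2 by near: x; apply: nbhs_right_lt; lra.
  have := ratio_decr_lt (lexx 0) V_lt0 x0 xt.
  suff : F x / x < F (t / 2) / (t / 2) by lra.
  by near: x; exact: (cvgr_lt _ cvF).
apply: (@second_order_criterion _ p F Phi C0 C1 0 (dF 0)) => //.
- by move=> x y x0 xy; exact: (ratio_decr_lt (lexx 0) V_lt0).
- by move=> y y0; rewrite ltr_pdivrMr// F_lt.
- move=> t t0 _.
  have hd (x : R) : is_derive x 1 (fun x => 2 * Phi x - dF 0 * (x * x))
      (2 * (F x - dF 0 * x)).
    have h := is_derive_funB
      (is_derive_funM (is_derive_fun_cst 2 x) (dPhi x))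
      (is_derive_funM (is_derive_fun_cst (dF 0) x)
       (is_derive_funM (is_derive_fun_id x) (is_derive_fun_id x))).
    by apply: (is_derive_eq h); ring.
  have := is_derive_lt0_lt t0 (fun x _ _ => hd x).
  rewrite Phi0 !mulr0 subr0 subr_lt0 expr2; apply => x x0 _.
  by rewrite pmulr_rlt0// subr_lt0 F_lt.
- by rewrite Phi0 expr2 !mulr0.
- move=> r rdF.
  near (0:R)^'+ => t.
  have t0 : 0 < t by near: t; exact: nbhs_right_gt.
  have hr (x : R) : 0 < x -> x <= t -> r < F x / x.
    move=> x0; rewrite le_eqVlt => /predU1P[->|xt].
      by near: t; exact: (cvgr_gt _ cvF).
    apply: lt_trans (ratio_decr_lt (lexx 0) V_lt0 x0 xt).
    by near: t; exact: (cvgr_gt _ cvF).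
  exists t => //.
  have hd (x : R) : is_derive x 1 (fun x => 2 * Phi x - r * (x * x))
      (2 * (F x - r * x)).
    have h := is_derive_funB
      (is_derive_funM (is_derive_fun_cst 2 x) (dPhi x))
      (is_derive_funM (is_derive_fun_cst r x)
       (is_derive_funM (is_derive_fun_id x) (is_derive_fun_id x))).
    by apply: (is_derive_eq h); ring.
  have := is_derive_gt0_lt t0 (fun x _ _ => hd x).
  rewrite Phi0 !mulr0 subr0 subr_gt0 expr2; apply => x x0 xt.
  by rewrite pmulr_rgt0// subr_gt0 -ltr_pdivlMr// hr// ltW.
Unshelve. all: by end_near. Qed.

(** [V] changes sign at [t1] and [U] at [tc]. Since [U' = V] is positive before [t1], [U] is still
    positive at [t1]; hence [t1 < tc], and [F t / t] already decreases at [tc]. The equation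
    [U(tc) = 0] gives the common value [rc] of the two ratios. *)
Lemma convex_concave_first_order (ts : R) : 0 < ts ->
  (forall t : R, 0 < t -> t < ts -> 0 < ddF t) ->
  (forall t : R, ts < t -> ddF t < 0) -> first_order p.
Proof.
move=> ts0 ddF_gt0 ddF_lt0.
have V_gt0 (t : R) : 0 < t -> t < ts -> 0 < t * dF t - F t.
  move=> t0 tts; have [c [c0 ct ->]] := dF_cst_MVT t0.
  rewrite -mulrBr pmulr_rgt0// subr_gt0.
  apply: (is_derive_gt0_lt ct (fun z cz _ => ddF_ (lt_le_trans c0 cz))) => z cz zt.
  by apply: ddF_gt0; [exact: lt_trans cz|exact: lt_trans tts].
have [t' tst' Vt'] : exists2 t', ts <= t' & t' * dF t' - F t' <= 0.
  apply: contrapT => hn.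
  have V_gt0' (t : R) : 0 < t -> 0 < t * dF t - F t.
    move=> t0; have [tts|tst] := ltP t ts; first exact: V_gt0.
    by rewrite ltNge; apply/negP => hV; apply: hn; exists t.
  have := F_gt0 ts0; set r := F ts / ts => Fts0.
  have r0 : 0 < r by rewrite divr_gt0.
  (* If [V] stayed positive, [F t / t] would exceed [r]; at this point [r * t = r * ts + 1 > 1],
     against [F t < 1]. *)
  pose t := ts + r^-1.
  have tts : ts < t by rewrite ltrDl invr_gt0.
  have t0 : 0 < t by exact: lt_trans tts.
  have : r < F t / t.
    apply: (@is_derive_gt0_lt _ (fun x => F x / x) _ _ _ tts
      (fun z xz _ => dratio (lt_le_trans ts0 xz))) => z xz _.
    have z0 := lt_trans ts0 xz.
    by rewrite divr_gt0 ?exprn_gt0//; exact: V_gt0'.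
  rewrite ltr_pdivlMr// mulrDr mulfV ?gt_eqF//.
  have := F_lt1 t0; have := mulr_gt0 r0 ts0; lra.
have [t1 [tst1 Vt1 V_pos V_neg]] : exists t1, [/\ ts <= t1, t1 * dF t1 - F t1 = 0,
    forall x, 0 < x -> x < t1 -> 0 < x * dF x - F x &
    forall x, t1 < x -> x * dF x - F x < 0].
  apply: (@single_sign_change _ (fun x => x * dF x - F x) (fun x => x * ddF x)
    ts t') => //.
  move=> x tsx; rewrite pmulr_rlt0; first exact: ddF_lt0.
  exact: lt_trans tsx.
have t10 : 0 < t1 by exact: lt_le_trans tst1.
have U_pos (x : R) : 0 < x -> x <= t1 -> 0 < x * F x - 2 * Phi x.
  move=> x0 xt1; have := is_derive_gt0_lt x0 (fun x _ _ => dU x).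
  rewrite Phi0 !(mulr0,mul0r) subrr; apply => z z0 zx.
  by apply: V_pos => //; exact: lt_le_trans xt1.
have [t2 t12 Ut2] : exists2 t2, t1 <= t2 & t2 * F t2 - 2 * Phi t2 <= 0.
  apply: contrapT => hn.
  have U_pos' (t : R) : 0 < t -> 0 < t * F t - 2 * Phi t.
    move=> t0; have [tts|tst] := leP t t1; first exact: U_pos.
    by rewrite ltNge; apply/negP => hV; apply: hn; exists t => //; exact: ltW.
  have Phi_t1 : 0 < Phi t1.
    have := is_derive_gt0_lt t10 (fun x _ _ => dPhi x).
    by rewrite Phi0; apply => x x0 _; exact: F_gt0.
  set r := 2 * Phi t1 / (t1 * t1).
  have r0 : 0 < r by rewrite divr_gt0// mulr_gt0.
  (* The analogous contradiction with [Phi t <= t]: here [r * t > 2], whereas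
     [2 * Phi t / t ^ 2 <= 2 / t]. *)
  pose t := t1 + 2 * r^-1.
  have tts : t1 < t by rewrite ltrDl mulr_gt0// invr_gt0.
  have t0 : 0 < t by exact: lt_trans tts.
  have : r < 2 * Phi t / (t * t).
    apply: (@is_derive_gt0_lt _ (fun x => 2 * Phi x / (x * x)) _ _ _ tts
      (fun z xz _ => dM (lt_le_trans t10 xz))) => z xz _.
    have z0 := lt_trans t10 xz.
    by rewrite divr_gt0 ?exprn_gt0// mulr_gt0//; exact: U_pos'.
  rewrite ltr_pdivlMr ?mulr_gt0// mulrA.
  have -> : r * t = r * t1 + 2.
    by rewrite /t mulrDr mulrCA mulfV ?mulr1// gt_eqF.
  have := Phi_le t0; have := mulr_gt0 (mulr_gt0 r0 t10) t0; lra.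
have [tc [t1tc Utc Uc_pos Uc_neg]] : exists t1', [/\ t1 <= t1',
    t1' * F t1' - 2 * Phi t1' = 0,
    forall x, 0 < x -> x < t1' -> 0 < x * F x - 2 * Phi x &
    forall x, t1' < x -> x * F x - 2 * Phi x < 0].
  apply: (@single_sign_change _ (fun x => x * F x - 2 * Phi x)
    (fun x => x * dF x - F x) t1 t2) => //.
  by move=> x x0 /ltW; exact: U_pos.
have tc0 : 0 < tc by exact: lt_le_trans t1tc.
have V_neg' (x : R) : tc < x -> x * dF x - F x < 0.
  by move=> tcx; apply: V_neg; exact: le_lt_trans tcx.
have t1_lt_tc : t1 < tc.
  rewrite lt_neqAle t1tc andbT; apply/eqP => e.
  by have := U_pos _ t10 (lexx _); rewrite e Utc ltxx.
pose rc := F tc / tc.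
have rc0 : 0 < rc by rewrite divr_gt0// F_gt0.
have Phi_tc : 2 * Phi tc = rc * tc ^+ 2.
  have -> : rc * tc ^+ 2 = tc * F tc by rewrite /rc; field; rewrite gt_eqF.
  lra.
have M_tc : 2 * Phi tc / (tc * tc) = rc.
  by rewrite Phi_tc; field; rewrite gt_eqF.
have M_lt (t : R) : 0 < t -> t != tc -> 2 * Phi t / (t * t) < rc.
  move=> t0; rewrite -M_tc neq_lt => /orP[ttc|tct].
    apply: (@is_derive_gt0_lt _ (fun x => 2 * Phi x / (x * x)) _ _ _ ttc
      (fun z xz _ => dM (lt_le_trans t0 xz))) => z xz ztc.
    have z0 := lt_trans t0 xz.
    by rewrite divr_gt0 ?exprn_gt0// mulr_gt0//; exact: Uc_pos.
  apply: (@is_derive_lt0_lt _ (fun x => 2 * Phi x / (x * x)) _ _ _ tct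
    (fun z xz _ => dM (lt_le_trans tc0 xz))) => z xz ztc.
  have z0 := lt_trans tc0 xz.
  rewrite pmulr_llt0 ?invr_gt0 ?exprn_gt0// pmulr_rlt0//; exact: Uc_neg.
apply: (@first_order_criterion _ p F Phi C0 C1 tc rc) => //.
- by move=> x y; apply: ratio_decr_lt => //; exact: ltW.
- move=> y tcy; apply: (@is_derive_lt0_lt _ (fun x => F x / x) _ _ _ tcy
    (fun z xz _ => dratio (lt_le_trans tc0 xz))) => z xz _.
  have z0 := lt_trans tc0 xz.
  by rewrite pmulr_llt0 ?invr_gt0 ?exprn_gt0//; exact: V_neg'.
- by move=> t t0 ttc; rewrite -ltr_pdivrMr ?exprn_gt0// expr2 M_lt.
- by rewrite Phi_tc.
- move=> t t0 ht; rewrite ltNge le_eqVlt; apply/negP => /predU1P[e|ttc].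
    by move: ht; rewrite e; lra.
  by have := Uc_pos _ t0 ttc; lra.
- by move=> r rrc; exists tc => //; rewrite Phi_tc ltr_pM2r// exprn_gt0.
Qed.

End PhaseTransitionCriteria.

(** * Integrals on half lines *)

Section IntegralsOnTheHalfLine.
Variable R : realType.
Local Notation mu := (@lebesgue_measure R).
Local Notation Rpos := (`]0%R, +oo[%classic : set R).
Implicit Types (f g F : R -> R) (D : set R).

Lemma measurable_fun_pos f D : measurable D -> D `<=` Rpos ->
  (forall x : R, 0 < x -> {for x, continuous f}) -> measurable_fun D f.
Proof.
move=> mD D0 cf; apply: (measurable_funS _ D0) => //.
apply: open_continuous_measurable_fun; first exact: interval_open.
by move=> x; rewrite inE/= in_itv/= andbT; exact: cf.
Qed.

Lemma ge0_FTC_itvcy (f F : R -> R) (a B : R) : 0 < a ->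
  (forall x : R, 0 < x -> 0 <= f x) ->
  (forall x : R, 0 < x -> {for x, continuous f}) ->
  (forall x : R, 0 < x -> is_derive x 1 F (f x)) ->
  F x @[x --> +oo%R] --> B ->
  (\int[mu]_(x in `[a, +oo[) (f x)%:E = (B - F a)%:E)%E.
Proof.
move=> a0 f0 cf dF FB; rewrite (@ge0_continuous_FTC2y _ f F a B)//.
- by move=> x ax; apply: f0; exact: lt_le_trans ax.
- apply/continuous_within_itvcyP; split.
    by move=> x; rewrite in_itv/= andbT => ax; apply: cf; exact: lt_trans ax.
  exact/cvg_at_right_filter/cf.
- by move=> x ax; have [] := dF x (lt_trans a0 ax).
- apply: cvg_at_right_filter; exact: is_derive_continuous (dF _ a0).
- move=> x; rewrite in_itv/= andbT => ax; rewrite derive1E.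
  exact: (@derive_val _ _ _ _ _ _ _ (dF x (lt_trans a0 ax))).
Qed.

Lemma ge0_FTC_itvcy_integrable (f F : R -> R) (a B : R) : 0 < a ->
  (forall x : R, 0 < x -> 0 <= f x) ->
  (forall x : R, 0 < x -> {for x, continuous f}) ->
  (forall x : R, 0 < x -> is_derive x 1 F (f x)) ->
  F x @[x --> +oo%R] --> B ->
  mu.-integrable `[a, +oo[ (EFin \o f).
Proof.
move=> a0 f0 cf dF FB; apply/integrableP; split.
  apply/measurable_EFinP; apply: measurable_fun_pos => // x /=.
  by rewrite !in_itv/= !andbT; exact: lt_le_trans.
under eq_integral => x.
  rewrite inE/= in_itv/= andbT => ax.
  rewrite /= ger0_norm ?f0//; last exact: lt_le_trans ax.
  over.
by rewrite (ge0_FTC_itvcy a0 f0 cf dF FB) ltry.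
Qed.

Lemma cvg_integral_itvcy f (f0 : forall x : R, 0 < x -> 0 <= f x) :
  measurable_fun Rpos f ->
  (\int[mu]_(x in `[(n.+1%:R^-1)%R, +oo[) (f x)%:E @[n --> \oo] -->
   \int[mu]_(x in Rpos) (f x)%:E)%E.
Proof.
move=> mf; rewrite itvoyEbigcup.
under [in X in _ --> X]eq_bigcupr do rewrite add0r.
apply: ge0_nondecreasing_set_cvg_integral.
- move=> m n mn; apply/subsetPset => x /=; rewrite !in_itv/= !andbT.
  by apply: le_trans; rewrite lef_pV2 ?posrE// ler_nat.
- by move=> n; exact: measurable_itv.
- move=> n; apply/measurable_EFinP; apply: measurable_funS mf => // x /=.
  by rewrite !in_itv/= !andbT; apply: lt_le_trans; rewrite invr_gt0.
- move=> n x /=; rewrite in_itv/= andbT lee_fin => nx; apply: f0.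
  by apply: lt_le_trans nx; rewrite invr_gt0.
Qed.

(** Monotone convergence over [[1 / (n + 1), +oo)] allows a primitive known only on the open half
    line. As the integrand must be nonnegative, a sign-changing one will first be shifted by an
    explicit function. *)
Lemma ge0_FTC_itvoy (f F : R -> R) (A B : R) :
  (forall x : R, 0 < x -> 0 <= f x) ->
  (forall x : R, 0 < x -> {for x, continuous f}) ->
  (forall x : R, 0 < x -> is_derive x 1 F (f x)) ->
  F x @[x --> 0^'+] --> A -> F x @[x --> +oo%R] --> B ->
  (\int[mu]_(x in Rpos) (f x)%:E = (B - A)%:E)%E.
Proof.
move=> f0 cf dF FA FB.
have mf : measurable_fun Rpos f by exact: measurable_fun_pos.
have h := cvg_integral_itvcy f0 mf.
apply: (cvg_unique _ h) => //.
rewrite (_ : (fun n => _) = (fun n => (B - F n.+1%:R^-1)%:E)); last first.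
  by apply/funext => n; rewrite (ge0_FTC_itvcy _ f0 cf dF FB)// invr_gt0.
apply: cvg_EFin; first exact: nearW.
apply: cvgB; first exact: cvg_cst.
move/cvg_at_rightP : FA; apply; split=> [n|]; first by rewrite invr_gt0.
exact: cvg_harmonic.
Qed.

Lemma ge0_FTC_integrable (f F : R -> R) (A B : R) :
  (forall x : R, 0 < x -> 0 <= f x) ->
  (forall x : R, 0 < x -> {for x, continuous f}) ->
  (forall x : R, 0 < x -> is_derive x 1 F (f x)) ->
  F x @[x --> 0^'+] --> A -> F x @[x --> +oo%R] --> B ->
  mu.-integrable Rpos (EFin \o f).
Proof.
move=> f0 cf dF FA FB; apply/integrableP; split.
  by apply/measurable_EFinP; exact: measurable_fun_pos.
under eq_integral => x.
  rewrite inE/= in_itv/= andbT => x0; rewrite /= ger0_norm ?f0//; over.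
by rewrite (ge0_FTC_itvoy f0 cf dF FA FB) ltry.
Qed.

Lemma dominated_integrable f g D : measurable D -> measurable_fun D f ->
  mu.-integrable D (EFin \o g) -> (forall x, D x -> `|f x| <= g x) ->
  mu.-integrable D (EFin \o f).
Proof.
move=> mD mf ig fg; apply: (@le_integrable _ _ _ mu D mD _ (EFin \o g)) => //.
  exact/measurable_EFinP.
by move=> x Dx; rewrite /= lee_fin (le_trans (fg x Dx))// ler_norm.
Qed.

Lemma integrableZl_fun f k D : measurable D -> mu.-integrable D (EFin \o f) ->
  mu.-integrable D (EFin \o (fun x => k * f x)).
Proof. move=> mD intf; exact: (@integrableZl _ _ _ mu D mD k _ intf). Qed.

Lemma integrableD_fun f g D : measurable D -> mu.-integrable D (EFin \o f) ->
  mu.-integrable D (EFin \o g) -> mu.-integrable D (EFin \o (fun x => f x + g x)).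
Proof. by move=> mD hf hg; exact: (@integrableD _ _ _ mu D mD _ _ hf hg). Qed.

Lemma integrableB_fun f g D : measurable D -> mu.-integrable D (EFin \o f) ->
  mu.-integrable D (EFin \o g) -> mu.-integrable D (EFin \o (fun x => f x - g x)).
Proof. by move=> mD hf hg; exact: (@integrableB _ _ _ mu D mD _ _ hf hg). Qed.

(** A nonnegative function of zero integral vanishes almost everywhere, but []a, b[] has positive
    measure. *)
Lemma Rintegral_gt0 f D (a b : R) : measurable D -> mu.-integrable D (EFin \o f) ->
  (forall x, D x -> 0 <= f x) -> a < b -> `]a, b[ `<=` D ->
  (forall x, a < x < b -> 0 < f x) -> 0 < \int[mu]_(x in D) f x.
Proof.
move=> mD intf f0 ab abD fpos.
rewrite lt_neqAle Rintegral_ge0// andbT eq_sym; apply/eqP => int0.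
have mf := measurable_int _ intf.
have : (\int[mu]_(x in D) `|(EFin \o f) x| = 0)%E.
  rewrite -[RHS]/(0%:E) -int0 /Rintegral fineK; last exact: integrable_fin_num.
  apply: eq_integral => x; rewrite inE => Dx.
  by rewrite /= ger0_norm// f0.
move/(ae_eq_integral_abs mu mD mf) => [N [mN N0 hN]].
have : (mu `]a, b[ <= mu N)%E.
  apply: le_measure; rewrite ?inE//.
  move=> x xab; apply: hN => /= h.
  have := h (abD _ xab) => -[fx0].
  by have := fpos x; rewrite fx0 ltxx; move: xab; rewrite /= in_itv/= => -> /(_ isT).
by rewrite N0 lebesgue_measure_itv/= lte_fin ab -EFinB lee_fin; lra.
Qed.

Lemma integrable_pos_sub f D : measurable D -> D `<=` Rpos ->
  mu.-integrable Rpos (EFin \o f) -> mu.-integrable D (EFin \o f).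
Proof. by move=> mD D0; exact: integrableS. Qed.

Lemma Rintegral_split f (a : itv_bound R) (t : R) :
  mu.-integrable [set` Interval a +oo%O] (EFin \o f) -> (a <= BLeft t)%O ->
  \int[mu]_(x in [set` Interval a +oo%O]) f x =
  \int[mu]_(x in [set` Interval a (BLeft t)]) f x + \int[mu]_(x in `[t, +oo[) f x.
Proof.
move=> intf at_.
have e : [set` Interval a +oo%O] = [set` Interval a (BLeft t)] `|` `[t, +oo[.
  by rewrite -itv_bndbnd_setU//.
rewrite e Rintegral_setU//; first by rewrite -e.
apply/disj_setPS => x [] /=; rewrite !itv_boundlr/= => /andP[_ h1] /andP[h2 _].
by move: h1; rewrite !bnd_simp in h2 *; rewrite ltNge h2.
Qed.

Lemma Rintegral_tail_approx f (a e : R) : 0 < a -> 0 < e ->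
  mu.-integrable Rpos (EFin \o f) ->
  exists t, [/\ 0 < t, t < a &
    `|\int[mu]_(x in Rpos) f x - \int[mu]_(x in `[t, +oo[) f x| < e].
Proof.
move=> a0 e0 intf.
have intnf : mu.-integrable Rpos (EFin \o (fun x => `|f x|)).
  exact: integrable_norm.
have mnf : measurable_fun Rpos (fun x => `|f x|).
  by have /integrableP[/measurable_EFinP] := intnf.
have sub (t : R) : 0 < t -> `[t, +oo[ `<=` Rpos.
  move=> t0 x /=; rewrite !in_itv/= !andbT; exact: lt_le_trans.
have tailE t : 0 < t ->
    (\int[mu]_(x in `[t, +oo[) `|f x|%:E = (\int[mu]_(x in `[t, +oo[) `|f x|)%:E)%E.
  move=> t0; rewrite /Rintegral fineK//; apply: integrable_fin_num => //.
  exact: (integrable_pos_sub _ (sub _ t0) intnf).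
have := @cvg_integral_itvcy (fun x => `|f x|) (fun x _ => normr_ge0 _) mnf.
rewrite (_ : (fun n => _) =
  (fun n => (\int[mu]_(x in `[n.+1%:R^-1, +oo[) `|f x|)%:E)); last first.
  by apply/funext => n; rewrite tailE// invr_gt0.
rewrite (_ : integral _ _ _ = (\int[mu]_(x in Rpos) `|f x|)%:E); last first.
  by rewrite /Rintegral fineK//; exact: integrable_fin_num.
move/fine_cvg => /= /cvgrPdist_lt/(_ _ e0) h.
have h2 : \forall n \near \oo, n.+1%:R^-1 < a.
  by have := @cvg_harmonic R; move/cvgr_lt; exact.
near \oo => n.
have na : n.+1%:R^-1 < a by near: n.
have ne : `|\int[mu]_(x in Rpos) `|f x| -
            \int[mu]_(x in `[n.+1%:R^-1, +oo[) `|f x| | < e by near: n.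
move: na ne; set t : R := n.+1%:R^-1 => ta te.
have t0 : 0 < t by rewrite invr_gt0.
exists t; split => //; move: te.
have t0' : (BRight 0 <= BLeft t)%O by rewrite bnd_simp.
rewrite !(Rintegral_split _ t0')// !addrK; apply: le_lt_trans.
rewrite (le_trans (le_normr_Rintegral _ _))//; last exact: ler_norm.
apply: (integrable_pos_sub _ _ intf) => //.
by move=> x /=; rewrite !in_itv/= => /andP[->].
Unshelve. all: by end_near. Qed.

Lemma ge0_Rintegral_scale f (t : R) : 0 < t ->
  (forall x : R, 0 < x -> {for x, continuous f}) ->
  (forall x : R, 0 < x -> 0 <= f x) ->
  (\int[mu]_(x in `[t, +oo[) (f x)%:E =
   \int[mu]_(w in `[1%R, +oo[) (f (t * w) * t)%:E)%E.
Proof.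
move=> t0 cf f0.
have dm (x : R) : is_derive x 1 (fun w => t * w) t.
  by apply: (is_derive_eq (is_derive_funM (is_derive_fun_cst t x) (is_derive_fun_id x))); ring.
have dE : derive1 (fun w => t * w) = cst t.
  by apply/funext => x; rewrite derive1E; exact: (@derive_val _ _ _ _ _ _ _ (dm x)).
have := @increasing_ge0_integration_by_substitutiony R (fun w => t * w) f 1.
rewrite mulr1 dE => ->//.
- by move=> x y _ _ xy; rewrite ltr_pM2l.
- by move=> x _; exact: cvg_cst.
- exact: is_cvg_cst.
- exact: is_cvg_cst.
- split; first by move=> x _; have [] := dm x.
  apply: cvg_at_right_filter; exact: is_derive_continuous (dm 1).
- exact: gt0_cvgMry.
- apply/continuous_within_itvcyP; split.
    by move=> x; rewrite in_itv/= andbT => ax; apply: cf; exact: lt_trans ax.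
  exact/cvg_at_right_filter/cf.
- by move=> x; rewrite in_itv/= andbT => ax; apply: f0; exact: lt_trans ax.
Qed.

Lemma Rintegral_scale f (t : R) : 0 < t ->
  (forall x : R, 0 < x -> {for x, continuous f}) ->
  \int[mu]_(x in `[t, +oo[) f x = \int[mu]_(w in `[1, +oo[) (f (t * w) * t).
Proof.
move=> t0 cf; rewrite /Rintegral integralE [in RHS]integralE.
have cp (g : R -> R) : (forall x : R, 0 < x -> {for x, continuous g}) ->
    forall x : R, 0 < x -> {for x, continuous (fun x => Num.max (g x) 0)}.
  move=> cg x x0; apply: (@continuous_max _ _ g (cst 0)); first exact: cg.
  exact: cvg_cst.
congr (fine (_ - _)).
  transitivity (\int[mu]_(x in `[t, +oo[) (Num.max (f x) 0)%:E)%E.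
    by apply: eq_integral => x _; rewrite funeposE EFin_max.
  rewrite (ge0_Rintegral_scale t0 (cp _ cf)); last by move=> x _; rewrite le_max lexx orbT.
  apply: eq_integral => x _; rewrite funeposE -EFin_max.
  by rewrite maxr_pMl ?mul0r// ltW.
transitivity (\int[mu]_(x in `[t, +oo[) (Num.max (- f x) 0)%:E)%E.
  by apply: eq_integral => x _; rewrite funenegE EFin_max.
have cNf (x : R) : 0 < x -> {for x, continuous (fun x => - f x)}.
  by move=> x0; apply: continuousN; exact: cf.
rewrite (ge0_Rintegral_scale t0 (cp _ cNf)); last by move=> x _; rewrite le_max lexx orbT.
apply: eq_integral => x _; rewrite funenegE -EFin_max.
by rewrite maxr_pMl ?mul0r ?mulNr// ltW.
Qed.

End IntegralsOnTheHalfLine.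

(** * The response function and its derivatives *)

Section Response.
Variables (R : realType) (c : R).
Hypothesis c_gt1 : 1 < c.
Local Notation mu := (@lebesgue_measure R).
Local Notation Rpos := (`]0%R, +oo[%classic : set R).

(* With [c = q - 1], [F0] averages [resp (t * W)]. *)
Definition resp (y : R) : R := (expR y - 1) / (expR y + c).
Definition resp1 (y : R) : R := (c + 1) * expR y / (expR y + c) ^+ 2.
Definition resp2 (y : R) : R :=
  (c + 1) * (expR y * (c - expR y)) / (expR y + c) ^+ 3.

Local Ltac clra := have ? := c_gt1; lra.
Local Ltac cnra := have ? := c_gt1; nra.

Let den_gt0 (y : R) : 0 < expR y + c.
Proof. by have := expR_gt0 y; clra. Qed.

Let dden (y : R) : is_derive y 1 (fun x => expR x + c) (expR y).
Proof.
by apply: (is_derive_eq (is_derive_funD (is_derive_expR y) (is_derive_fun_cst c y))); rewrite addr0.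
Qed.

Lemma is_derive_resp (y : R) : is_derive y 1 resp (resp1 y).
Proof.
have h := is_derive_funM (is_derive_funB (is_derive_expR y) (is_derive_fun_cst 1 y))
  (@is_derive_funV_pos _ (fun x => expR x + c) _ _ (den_gt0 y) (dden y)).
by apply: (is_derive_eq h); rewrite /resp1; field; rewrite gt_eqF.
Qed.

Lemma is_derive_resp1 (y : R) : is_derive y 1 resp1 (resp2 y).
Proof.
have d2 : 0 < (expR y + c) * (expR y + c) by rewrite mulr_gt0.
have h : is_derive y 1 (fun x => (c + 1) * expR x / ((expR x + c) * (expR x + c))) _ :=
  is_derive_funM (is_derive_funM (is_derive_fun_cst (c + 1) y) (is_derive_expR y))
  (@is_derive_funV_pos _ (fun x => (expR x + c) * (expR x + c)) _ _ d2
     (is_derive_funM (dden y) (dden y))).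
by apply: (is_derive_eq h); rewrite /resp2; field; rewrite gt_eqF.
Qed.

Lemma is_derive_ln_den (y : R) : is_derive y 1 (fun x => ln (expR x + c))
  (expR y / (expR y + c)).
Proof.
have h := @is_derive_fun_comp _ (@ln R) (fun x => expR x + c) _ _ _ (dden y)
  (is_derive1_ln (den_gt0 y)).
by apply: (is_derive_eq h); rewrite mulrC.
Qed.

Lemma continuous_resp (y : R) : {for y, continuous resp}.
Proof. exact: is_derive_continuous (is_derive_resp y). Qed.

Lemma continuous_resp2 (y : R) : {for y, continuous resp2}.
Proof.
have d3 : 0 < (expR y + c) * ((expR y + c) * (expR y + c)) by rewrite !mulr_gt0.
have h := is_derive_funM (is_derive_funM (is_derive_fun_cst (c + 1) y)
   (is_derive_funM (is_derive_expR y)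
      (is_derive_funB (is_derive_fun_cst c y) (is_derive_expR y))))
  (@is_derive_funV_pos _ (fun x => (expR x + c) * ((expR x + c) * (expR x + c))) _ _ d3
     (is_derive_funM (dden y) (is_derive_funM (dden y) (dden y)))).
exact: is_derive_continuous h.
Qed.

Lemma resp0 : resp 0 = 0.
Proof. by rewrite /resp expR0 subrr mul0r. Qed.

Lemma resp1_0 : resp1 0 = (c + 1)^-1.
Proof. by rewrite /resp1 expR0; field; rewrite gt_eqF//; clra. Qed.

Lemma resp_lt1 (y : R) : resp y < 1.
Proof. by rewrite /resp ltr_pdivrMr// mul1r; clra. Qed.

Lemma resp_gt0 (y : R) : 0 < y -> 0 < resp y.
Proof. by move=> y0; rewrite /resp divr_gt0// subr_gt0 expR_gt1. Qed.

Lemma norm_resp_le (y : R) : `|resp y| <= 1.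
Proof.
rewrite ler_norml (ltW (resp_lt1 y)) andbT /resp ler_pdivlMr//.
by have := expR_gt0 y; clra.
Qed.

Lemma resp1_gt0 (y : R) : 0 < resp1 y.
Proof. by rewrite /resp1 divr_gt0 ?exprn_gt0// mulr_gt0 ?expR_gt0//; clra. Qed.

Lemma resp1_le2 (y : R) : resp1 y <= 2.
Proof.
rewrite /resp1 ler_pdivrMr ?exprn_gt0//.
have := expR_gt0 y; cnra.
Qed.

Lemma resp1_le_expN (y : R) : resp1 y <= (c + 1) * expR (- y).
Proof.
rewrite /resp1 expRN -mulrA ler_pM2l; last clra.
rewrite ler_pdivrMr ?exprn_gt0// mulrC ler_pdivlMr ?expR_gt0//.
have := expR_gt0 y; cnra.
Qed.

Lemma norm_resp2_le (y : R) : `|resp2 y| <= resp1 y.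
Proof.
have -> : resp2 y = resp1 y * ((c - expR y) / (expR y + c)).
  by rewrite /resp1 /resp2; field; rewrite gt_eqF.
rewrite normrM (ger0_norm (ltW (resp1_gt0 y))) ger_pMr ?resp1_gt0//.
rewrite ler_norml ler_pdivlMr// ler_pdivrMr//.
by have := expR_gt0 y; clra.
Qed.

Lemma resp2_gt0 (y : R) : y < ln c -> 0 < resp2 y.
Proof.
move=> yc; rewrite /resp2 divr_gt0 ?exprn_gt0// !mulr_gt0 ?expR_gt0//; first clra.
by rewrite subr_gt0 -ltr_ln ?posrE ?expR_gt0 ?expRK//; clra.
Qed.

Lemma resp2_lt0 (y : R) : ln c < y -> resp2 y < 0.
Proof.
move=> yc; rewrite /resp2 pmulr_llt0 ?invr_gt0 ?exprn_gt0//.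
rewrite pmulr_rlt0 ?pmulr_rlt0 ?expR_gt0//; last clra.
by rewrite subr_lt0 -ltr_ln ?posrE ?expR_gt0 ?expRK//; clra.
Qed.

Lemma resp2_lnc : resp2 (ln c) = 0.
Proof. by rewrite /resp2 lnK ?posrE ?subrr ?mulr0 ?mul0r//; clra. Qed.

Lemma lnc_gt0 : 0 < ln c.
Proof. exact: ln_gt0. Qed.

Lemma cvg_resp1y : resp1 x @[x --> +oo%R] --> (0 : R).
Proof.
apply: (@squeeze_cvgr _ _ _ _ (cst 0) (fun x => (c + 1) * expR (- x))).
- by near=> x; rewrite /= (ltW (resp1_gt0 x)) resp1_le_expN.
- exact: cvg_cst.
- by rewrite -[X in _ --> X](mulr0 (c + 1)); apply: cvgMr; exact: cvgr_expR.
Unshelve. all: by end_near. Qed.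

Lemma cvg_respy : resp x @[x --> +oo%R] --> (1 : R).
Proof.
have e (x : R) : resp x = 1 - (c + 1) / (expR x + c).
  by rewrite /resp; field; rewrite gt_eqF.
rewrite (_ : resp = fun x => 1 - (c + 1) / (expR x + c)); last exact/funext.
rewrite -[X in _ --> X](subr0 1); apply: cvgB; first exact: cvg_cst.
apply: (@squeeze_cvgr _ _ _ _ (cst 0) (fun x => (c + 1) * expR (- x))).
- near=> x; rewrite /= divr_ge0 ?(ltW (den_gt0 _))//=; last clra.
  rewrite expRN ler_pM2l; last clra.
  by rewrite lef_pV2 ?posrE ?expR_gt0//; clra.
- exact: cvg_cst.
- by rewrite -[X in _ --> X](mulr0 (c + 1)); apply: cvgMr; exact: cvgr_expR.
Unshelve. all: by end_near. Qed.

End Response.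

(** * Random variables with a density *)

Section Density.
Variables (R : realType) (d : measure_display) (T : measurableType d).
Variables (P : probability T R) (W : {RV P >-> R}) (f : R -> R).
Local Notation mu := (@lebesgue_measure R).
Hypothesis f_ge0 : forall x, 0 <= f x.
Hypothesis mf : measurable_fun setT f.
Hypothesis hW : has_density W f.

(* The library gives [R] and [measurableTypeR R], on which the Lebesgue measure
   is defined, two convertible but distinct measurable structures. *)
Let W' : T -> measurableTypeR R := W.

Let mW' : measurable_fun setT W'.
Proof. exact: (measurable_funPT W). Qed.

HB.instance Definition _ := isMeasurableFun.Build _ _ T (measurableTypeR R) W' mW'.

Let nu : {finite_measure set (measurableTypeR R) -> \bar R} := distribution P W'.

Let nuE A : measurable A -> nu A = (\int[mu]_(x in A) (f x)%:E)%E.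
Proof. exact: hW. Qed.

Lemma density_dominates : nu `<< mu.
Proof.
apply/null_content_dominatesP => A mA muA.
rewrite nuE//; apply: null_set_integral => //.
  exact/measurable_EFinP/measurable_funTS.
Qed.

(** Change of variables holds with the Radon-Nikodym derivative of the law of [W]; this derivative
    equals [f] almost everywhere because both have the same integral over every measurable set. *)
Lemma ge0_integral_density (k : R -> \bar R) : measurable_fun setT k ->
  (forall x, 0 <= k x)%E ->
  (\int[P]_x k (W x) = \int[mu]_x (k x * (f x)%:E))%E.
Proof.
move=> mk k0.
rewrite -(ge0_integral_distribution W' mk k0).
rewrite -(Radon_Nikodym_SigmaFinite.change_of_variables density_dominates k0 measurableT mk).
apply: ae_eq_integral => //.
- apply: emeasurable_funM => //.
  exact: measurable_int (Radon_Nikodym_SigmaFinite.f_integrable density_dominates).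
- by apply: emeasurable_funM => //; exact/measurable_EFinP.
- apply: ae_eqe_mul2l; apply: integral_ae_eq => //.
  + exact: (Radon_Nikodym_SigmaFinite.f_integrable density_dominates).
  + exact/measurable_EFinP.
  + move=> A _ mA; rewrite -(Radon_Nikodym_SigmaFinite.f_integral density_dominates mA).
    exact: nuE.
Qed.

Lemma integral_density (k : R -> R) : measurable_fun setT k ->
  (\int[P]_x (k (W x))%:E = \int[mu]_x (k x * f x)%:E)%E.
Proof.
move=> mk; have mk' : measurable_fun setT (EFin \o k) by exact/measurable_EFinP.
rewrite integralE [RHS]integralE; congr (_ - _)%E.
  rewrite (_ : (fun x => _)^\+%E = fun x => ((EFin \o k)^\+%E (W x))); last first.
    by apply/funext => x; rewrite !funeposE.
  rewrite (ge0_integral_density (measurable_funepos mk'))//.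
  apply: eq_integral => x _; rewrite !funeposE /= -!EFin_max -EFinM.
  by rewrite maxr_pMl// mul0r.
rewrite (_ : (fun x => _)^\-%E = fun x => ((EFin \o k)^\-%E (W x))); last first.
  by apply/funext => x; rewrite !funenegE.
rewrite (ge0_integral_density (measurable_funeneg mk'))//.
apply: eq_integral => x _; rewrite !funenegE /= -!EFin_max -EFinM.
by rewrite maxr_pMl// mul0r mulNr.
Qed.

End Density.

(** * Expectations under the Pareto law *)

Section Pareto.
Variables (R : realType) (tau : R).
Local Notation mu := (@lebesgue_measure R).
Hypothesis tau1 : 1 < tau.

(** The density without its indicator: the domain of integration becomes [[1, +oo)] and the function
    is continuous on all positive reals, across [1] included. *)
Definition pareto_weight (w : R) : R := (tau - 1) * w `^ (- tau).

Lemma pareto_weight_ge0 w : 0 <= pareto_weight w.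
Proof. by rewrite mulr_ge0 ?powR_ge0// subr_ge0 ltW. Qed.

Lemma measurable_pareto_weight : measurable_fun setT pareto_weight.
Proof. by apply: measurable_funM => //; exact: measurable_powR. Qed.

Lemma expect_pareto (d : measure_display) (T : measurableType d)
    (P : probability T R) (W : {RV P >-> R}) (k : R -> R) :
  has_density W (pareto_pdf tau) -> measurable_fun setT k ->
  expect P (fun x => k (W x)) =
  \int[mu]_(w in `[1, +oo[) (k w * pareto_weight w).
Proof.
move=> hW mk; rewrite /expect /Rintegral unlock; congr fine.
rewrite (integral_density _ _ hW mk).
- rewrite [RHS]integral_mkcond; apply: eq_integral => x _.
  rewrite patchE; case: ifPn => x1.
    by rewrite /pareto_pdf indicE x1 mulr1.
  by rewrite /pareto_pdf indicE (negbTE x1) !mulr0.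
- by move=> x; rewrite mulr_ge0//; exact: pareto_weight_ge0.
- apply: measurable_funM; first exact: measurable_pareto_weight.
  exact: measurable_indic.
Qed.

End Pareto.

(** * Integrals against the Pareto density *)

Section PowerFunctions.
Variable R : realType.
Local Notation mu := (@lebesgue_measure R).

Lemma cvg_powRN_y (a : R) : 0 < a -> x `^ (- a) @[x --> +oo%R] --> (0 : R).
Proof.
move=> a0; apply/cvgr0Pnorm_lt => e e0; near=> x.
have x0 : 0 < x by near: x; exact: nbhs_pinfty_gt.
rewrite ger0_norm ?powR_ge0// /powR gt_eqF//.
rewrite -[ltRHS](lnK (_ : e \is Num.pos))// ltr_expR mulNr ltrNl -ltr_pdivrMl//.
have xe : expR (a^-1 * - ln e) < x by near: x; exact: nbhs_pinfty_gt.
by rewrite -[ltLHS]expRK ltr_ln ?posrE ?expR_gt0.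
Unshelve. all: by end_near. Qed.

Lemma powR_continuous (a x : R) : 0 < x -> {for x, continuous (fun y : R => y `^ a)}.
Proof. by move=> x0; exact: is_derive_continuous (is_derive1_powR a x0). Qed.

Lemma powRD_pos (x a b : R) : 0 < x -> x `^ (a + b) = x `^ a * x `^ b.
Proof. by move=> x0; rewrite powRD// (gt_eqF x0) implybT. Qed.

Lemma powR_mul_natr (x a : R) n : 0 < x -> x ^+ n * x `^ a = x `^ (n%:R + a).
Proof. by move=> x0; rewrite powRD_pos// powR_mulrn// ltW. Qed.

End PowerFunctions.

Section ParetoIntegrals.
Variables (R : realType) (tau : R).
Hypothesis tau_gt3 : 3 < tau.
Local Notation mu := (@lebesgue_measure R).
Local Notation D := (`[1%R, +oo[%classic : set R).
Local Notation rho := (pareto_weight tau).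
Local Ltac clra := have ? := tau_gt3; lra.

Let tau1 : 1 < tau. Proof. clra. Qed.

Let mD : measurable D. Proof. exact: measurable_itv. Qed.

Let Dge1 (w : R) : D w -> 1 <= w.
Proof. by rewrite /= in_itv/= andbT. Qed.

Let Dpos : D `<=` (`]0, +oo[ : set R).
Proof. by move=> w /Dge1 w1; rewrite /= in_itv/= andbT (lt_le_trans ltr01). Qed.

Lemma pareto_weight_gt0 (w : R) : 0 < w -> 0 < rho w.
Proof. by move=> w0; rewrite mulr_gt0 ?powR_gt0//; clra. Qed.

Lemma continuous_pareto_weight (w : R) : 0 < w -> {for w, continuous rho}.
Proof. by move=> w0; apply: continuousM; [exact: cvg_cst|exact: powR_continuous]. Qed.

(** This is where [tau > 3] enters: the finite second moment dominates all the integrals below and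
    all their derivatives in [t]. *)
Lemma integrable_sq_pareto_weight :
  mu.-integrable D (EFin \o (fun w : R => w ^+ 2 * rho w)).
Proof.
have iw : mu.-integrable D (EFin \o (fun w : R => w `^ (2 - tau))).
  have cw (x : R) : 0 < x -> {for x, continuous (fun w : R => w `^ (2 - tau))}.
    exact: powR_continuous.
  apply: (@ge0_FTC_itvcy_integrable _ (fun w => w `^ (2 - tau))
    (fun w => (3 - tau)^-1 * w `^ (3 - tau)) 1 0) => //.
  - by move=> x _; exact: powR_ge0.
  - move=> x x0; have h := is_derive_funM (is_derive_fun_cst (3 - tau)^-1 x)
      (is_derive1_powR (3 - tau) x0).
    apply: (is_derive_eq h); rewrite mul0r add0r mulrA mulVf ?mul1r.
      by congr (_ `^ _); ring.
    by rewrite lt_eqF//; clra.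
  - rewrite -[X in _ --> X](mulr0 (3 - tau)^-1); apply: cvgMr.
    rewrite -opprB; apply: cvg_powRN_y; clra.
have := @integrableZl_fun R _ (tau - 1) _ mD iw.
apply: eq_integrable => // w; rewrite inE => /Dge1 w1; rewrite /= /pareto_weight.
by rewrite mulrCA powR_mul_natr// (lt_le_trans ltr01).
Qed.

Lemma integrable_pareto (k : R -> R) (C : R) :
  (forall w : R, 0 < w -> {for w, continuous k}) ->
  (forall w : R, 1 <= w -> `|k w| <= C * w ^+ 2) ->
  mu.-integrable D (EFin \o (fun w : R => k w * rho w)).
Proof.
move=> ck kC.
have ig := @integrableZl_fun R _ C _ mD integrable_sq_pareto_weight.
apply: (dominated_integrable mD _ ig).
  apply: measurable_fun_pos => // w w0.
  by apply: continuousM; [exact: ck|exact: continuous_pareto_weight].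
move=> w /Dge1 w1; have w0 : 0 < w by exact: lt_le_trans w1.
rewrite normrM (ger0_norm (ltW (pareto_weight_gt0 w0))) mulrA ler_pM2r ?kC//.
exact: pareto_weight_gt0.
Qed.

Let continuous_scaled (h : R -> R) (n : nat) (t : R) : continuous h ->
  forall w : R, 0 < w -> {for w, continuous (fun w : R => w ^+ n * h (t * w))}.
Proof.
move=> ch w w0; apply: continuousM; first exact: exprn_continuous.
apply: continuous_comp; last exact: ch.
exact: mulrl_continuous.
Qed.

Lemma integrable_pareto_scaled (h : R -> R) (n : nat) (C t : R) : continuous h ->
  (forall w : R, 1 <= w -> `|w ^+ n * h (t * w)| <= C * w ^+ 2) ->
  mu.-integrable D (EFin \o (fun w : R => w ^+ n * h (t * w) * rho w)).
Proof.
by move=> ch hC; apply: integrable_pareto hC; exact: continuous_scaled.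
Qed.

(** The form [w ^+ n * h (t * w)] is stable under differentiation in [t], with [n] raised by one and
    [h] replaced by [dh]. Domination is asked only on a window []u, v[] around [a], since the bound
    for the second derivative degenerates as [t] tends to [0]. *)
Lemma is_derive_pareto_integral (h dh : R -> R) (n : nat) (C u v a : R) :
  (forall y : R, is_derive y 1 h (dh y)) -> u < a -> a < v ->
  (forall t w : R, u < t -> t < v -> 1 <= w -> `|w ^+ n * h (t * w)| <= C * w ^+ 2) ->
  (forall t w : R, u < t -> t < v -> 1 <= w ->
     `|w ^+ n.+1 * dh (t * w)| <= C * w ^+ 2) ->
  is_derive a 1 (fun t : R => \int[mu]_(w in D) (w ^+ n * h (t * w) * rho w))
    (\int[mu]_(w in D) (w ^+ n.+1 * dh (a * w) * rho w)).
Proof.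
move=> dh_ ua av hC dhC.
have ch : continuous h by move=> y; exact: is_derive_continuous (dh_ y).
pose f (t w : R) := w ^+ n * h (t * w) * rho w.
have df (t w : R) : is_derive t 1 (f^~ w) (w ^+ n.+1 * dh (t * w) * rho w).
  have hm := is_derive_funM (is_derive_fun_id t) (is_derive_fun_cst w t).
  have hh := is_derive_funM (is_derive_funM (is_derive_fun_cst (w ^+ n) t)
    (is_derive_fun_comp hm (dh_ (t * w)))) (is_derive_fun_cst (rho w) t).
  by apply: (is_derive_eq hh); rewrite exprS; ring.
have pf t w : partial1of2 f t w = w ^+ n.+1 * dh (t * w) * rho w.
  by rewrite partial1of2E; exact: (@derive_val _ _ _ _ _ _ _ (df t w)).
have Ia : `]u, v[%classic a by rewrite /= in_itv/= ua av.
have intf t : `]u, v[%classic t -> mu.-integrable D (EFin \o f t).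
  rewrite /= in_itv/= => /andP[ut tv]; apply: integrable_pareto_scaled => // w w1.
  exact: hC.
have derf t w : `]u, v[%classic t -> D w -> derivable (f^~ w) t 1.
  by move=> _ _; have [] := df t w.
pose G (w : R) := `|C| * (w ^+ 2 * rho w).
have G0 w : 0 <= G w.
  by rewrite mulr_ge0// mulr_ge0 ?sqr_ge0//; exact: pareto_weight_ge0.
have intG : mu.-integrable D (EFin \o G).
  exact: integrableZl_fun integrable_sq_pareto_weight.
have Gub t w : `]u, v[%classic t -> D w -> `|partial1of2 f t w| <= G w.
  rewrite pf /= in_itv/= => /andP[ut tv] /Dge1 w1.
  rewrite normrM [`|rho w|]ger0_norm ?pareto_weight_ge0// /G [leRHS]mulrA.
  apply: ler_wpM2r; first exact: pareto_weight_ge0.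
  apply: le_trans (dhC _ _ ut tv w1) _.
  by apply: ler_wpM2r; [exact: sqr_ge0|exact: ler_norm].
have h1 := @derivable_under_integral R _ _ mu f D mD a u v Ia intf derf G G0 intG Gub.
have h2 := @differentiation_under_integral R _ _ mu f D mD a u v Ia intf derf G G0 intG Gub.
apply: DeriveDef; first exact: h1.
by rewrite -derive1E h2; apply: eq_Rintegral => w _; rewrite pf.
Qed.

End ParetoIntegrals.

(** * The function [F_0], its derivatives and its primitive for a Pareto weight *)

Section ParetoResponse.
Variables (R : realType) (tau c : R).
Hypotheses (tau_gt3 : 3 < tau) (c_gt1 : 1 < c).
Local Notation mu := (@lebesgue_measure R).
Local Notation D := (`[1%R, +oo[%classic : set R).
Local Notation rho := (pareto_weight tau).
Local Ltac clra := have ? := tau_gt3; have ? := c_gt1; lra.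

Let mD : measurable D. Proof. exact: measurable_itv. Qed.

Let Dge1 (w : R) : D w -> 1 <= w.
Proof. by rewrite /= in_itv/= andbT. Qed.

Definition pareto_mean : R := \int[mu]_(w in D) (w * rho w).
Definition pareto_sqmean : R := \int[mu]_(w in D) (w ^+ 2 * rho w).
(** The factors [w ^+ 1] here and [w ^+ 0] in [pareto_lnmean] give the integrands the form required
    by [is_derive_pareto_integral]. *)
Definition pareto_F (t : R) : R :=
  pareto_mean^-1 * \int[mu]_(w in D) (w ^+ 1 * resp c (t * w) * rho w).
Definition pareto_dF (t : R) : R :=
  pareto_mean^-1 * \int[mu]_(w in D) (w ^+ 2 * resp1 c (t * w) * rho w).
Definition pareto_ddF (t : R) : R :=
  pareto_mean^-1 * \int[mu]_(w in D) (w ^+ 3 * resp2 c (t * w) * rho w).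
Definition pareto_lnmean (t : R) : R :=
  \int[mu]_(w in D) (w ^+ 0 * ln (expR (t * w) + c) * rho w).

Let le_sq (w : R) : 1 <= w -> w <= w ^+ 2.
Proof. by move=> w1; rewrite expr2 ler_peMl//; lra. Qed.

Let integrable_id : mu.-integrable D (EFin \o (fun w : R => w * rho w)).
Proof.
apply: (@integrable_pareto R tau tau_gt3 id 1) => [w w0|w w1].
  exact: cvg_id.
by rewrite mul1r ger0_norm; [exact: le_sq|lra].
Qed.

Lemma pareto_Rintegral_gt0 (f : R -> R) :
  mu.-integrable D (EFin \o (fun w : R => f w * rho w)) ->
  (forall w : R, 1 <= w -> 0 < f w) -> 0 < \int[mu]_(w in D) (f w * rho w).
Proof.
move=> intf f0; apply: (@Rintegral_gt0 R _ D 1 2) => //.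
- move=> w /Dge1 w1; apply: mulr_ge0; first exact/ltW/f0.
  by apply: pareto_weight_ge0; have := tau_gt3; lra.
- lra.
- by move=> w /=; rewrite !in_itv/= andbT => /andP[/ltW].
- move=> w /andP[w1 _]; rewrite mulr_gt0//; first exact/f0/ltW.
  by apply: pareto_weight_gt0 => //; exact: lt_trans w1.
Qed.

Lemma pareto_mean_gt0 : 0 < pareto_mean.
Proof. by apply: pareto_Rintegral_gt0 => // w w1; lra. Qed.

Lemma pareto_sqmean_gt0 : 0 < pareto_sqmean.
Proof.
apply: pareto_Rintegral_gt0 => [|w w1]; first exact: integrable_sq_pareto_weight.
by rewrite exprn_gt0//; lra.
Qed.

Let norm_w_resp (t w : R) : 1 <= w -> `|w ^+ 1 * resp c (t * w)| <= 2 * w ^+ 2.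
Proof.
move=> w1; rewrite normrM expr1 [`|w|]ger0_norm; last lra.
have h := norm_resp_le c_gt1 (t * w); have := le_sq w1.
have := normr_ge0 (resp c (t * w)); nra.
Qed.

Let norm_w_resp1 (t w : R) : 1 <= w -> `|w ^+ 2 * resp1 c (t * w)| <= 2 * w ^+ 2.
Proof.
move=> w1; rewrite ger0_norm.
  by rewrite mulrC ler_wpM2r ?sqr_ge0// resp1_le2.
by rewrite mulr_ge0 ?sqr_ge0// ltW// resp1_gt0.
Qed.

(** The extra power of [w] is absorbed by the exponential: [w * expR (- (t * w)) <= 1 / u], because
    [expR (t * w) >= t * w >= u * w]. *)
Let norm_w_resp2 (u t w : R) : 0 < u -> u < t -> 1 <= w ->
  `|w ^+ 3 * resp2 c (t * w)| <= (2 + (c + 1) / u) * w ^+ 2.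
Proof.
move=> u0 ut w1; have w0 : 0 < w by lra.
rewrite normrM [`|w ^+ 3|]ger0_norm ?exprn_ge0 ?(ltW w0)//.
have e : w * expR (- (t * w)) <= u^-1.
  rewrite expRN ler_pdivrMr ?expR_gt0// ler_pdivlMl//.
  apply: le_trans (expR_ge1Dx (t * w)).
  have : u * w <= t * w by rewrite ler_wpM2r// ltW.
  lra.
have := norm_resp2_le c_gt1 (t * w); have := resp1_le_expN c_gt1 (t * w).
move=> h1 h2; have h3 := le_trans h2 h1.
apply: (@le_trans _ _ (w ^+ 3 * ((c + 1) * expR (- (t * w))))).
  by rewrite ler_wpM2l// exprn_ge0// ltW.
rewrite (_ : w ^+ 3 * _ = (c + 1) * (w * expR (- (t * w))) * w ^+ 2); last by ring.
rewrite ler_wpM2r ?sqr_ge0//.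
apply: (@le_trans _ _ ((c + 1) * u^-1)); last by lra.
by rewrite ler_wpM2l//; clra.
Qed.

Lemma is_derive_pareto_F (t : R) : is_derive t 1 pareto_F (pareto_dF t).
Proof.
have h := @is_derive_pareto_integral R tau tau_gt3 _ _ 1 2 (t - 1) (t + 1) t
  (is_derive_resp c_gt1).
have := is_derive_funM (is_derive_fun_cst pareto_mean^-1 t)
  (h _ _ (fun s w _ _ w1 => norm_w_resp s w1) (fun s w _ _ w1 => norm_w_resp1 s w1)).
rewrite mul0r add0r; apply; lra.
Qed.

Lemma is_derive_pareto_dF (t : R) : 0 < t -> is_derive t 1 pareto_dF (pareto_ddF t).
Proof.
move=> t0; have u0 : 0 < t / 2 by lra.
have h := @is_derive_pareto_integral R tau tau_gt3 _ _ 2 (2 + (c + 1) / (t / 2))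
  (t / 2) (t + 1) t (is_derive_resp1 c_gt1).
have C0 : 0 <= (c + 1) / (t / 2) by rewrite divr_ge0//; clra.
have := is_derive_funM (is_derive_fun_cst pareto_mean^-1 t)
  (h _ _ _ (fun s w us _ w1 => norm_w_resp2 u0 us w1)).
rewrite mul0r add0r; apply; [lra|lra|].
move=> s w _ _ w1; apply: le_trans (norm_w_resp1 s w1) _.
by rewrite ler_wpM2r ?sqr_ge0//; lra.
Qed.

Lemma pareto_F_0 : pareto_F 0 = 0.
Proof.
rewrite /pareto_F (@eq_Rintegral _ _ _ mu _ (cst 0)) ?Rintegral_cst ?mul0r ?mulr0//.
by move=> w _; rewrite /= mul0r resp0 mulr0 mul0r.
Qed.

Let int_resp (t : R) :
  mu.-integrable D (EFin \o (fun w : R => w ^+ 1 * resp c (t * w) * rho w)).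
Proof.
apply: integrable_pareto_scaled => //; last first.
  by move=> w w1; exact: (norm_w_resp t w1).
by move=> y; exact: continuous_resp.
Qed.

Lemma pareto_F_gt0 (t : R) : 0 < t -> 0 < pareto_F t.
Proof.
move=> t0; rewrite /pareto_F mulr_gt0 ?invr_gt0 ?pareto_mean_gt0//.
apply: pareto_Rintegral_gt0 => // w w1.
by rewrite expr1 mulr_gt0 ?resp_gt0// ?mulr_gt0//; lra.
Qed.

Lemma pareto_F_lt1 (t : R) : pareto_F t < 1.
Proof.
rewrite /pareto_F mulrC ltr_pdivrMr ?pareto_mean_gt0// mul1r -subr_gt0 /pareto_mean -RintegralB//.
rewrite (@eq_Rintegral _ _ _ mu _ (fun w => (w * (1 - resp c (t * w))) * rho w)); last first.
  by move=> w _; rewrite expr1; ring.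
apply: pareto_Rintegral_gt0.
  have := integrableB_fun mD integrable_id (int_resp t).
  by apply: eq_integrable => // w _; rewrite /= expr1; congr EFin; ring.
move=> w w1; rewrite mulr_gt0 ?subr_gt0 ?resp_lt1//; lra.
Qed.

Lemma pareto_dF_0 : pareto_dF 0 = pareto_sqmean / pareto_mean / (c + 1).
Proof.
rewrite /pareto_dF (@eq_Rintegral _ _ _ mu _ (fun w => (c + 1)^-1 * (w ^+ 2 * rho w))); last first.
  by move=> w _; rewrite /= mul0r resp1_0//; ring.
rewrite RintegralZl//; last exact: integrable_sq_pareto_weight.
by rewrite -/pareto_sqmean; ring.
Qed.

Lemma pareto_ddFE (t : R) : 0 < t ->
  pareto_ddF t = pareto_mean^-1 * (tau - 1) * t `^ (tau - 4) *
    \int[mu]_(x in `[t, +oo[) (x `^ (3 - tau) * resp2 c x).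
Proof.
move=> t0.
have intr : mu.-integrable D (EFin \o (fun w : R => w ^+ 3 * resp2 c (t * w) * rho w)).
  have u0 : 0 < t / 2 by lra.
  apply: (@integrable_pareto_scaled R tau tau_gt3 (resp2 c) 3 (2 + (c + 1) / (t / 2)) t).
    by move=> y; exact: continuous_resp2.
  by move=> w w1; apply: norm_w_resp2 => //; lra.
rewrite Rintegral_scale//; last first.
  move=> x x0; apply: continuousM; first exact: powR_continuous.
  exact: continuous_resp2.
rewrite (@eq_Rintegral _ _ _ mu _ (fun w => ((tau - 1)^-1 * t `^ (4 - tau)) *
   (w ^+ 3 * resp2 c (t * w) * rho w))); last first.
  move=> w; rewrite inE => /Dge1 w1; have w0 : 0 < w by lra.
  rewrite /pareto_weight powRM ?(ltW t0) ?(ltW w0)//.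
  have -> : w `^ (3 - tau) = w ^+ 3 * w `^ (- tau) by rewrite powR_mul_natr.
  have -> : t `^ (4 - tau) = t * t `^ (3 - tau).
    by rewrite -[t in RHS]expr1 powR_mul_natr//; congr (_ `^ _); ring.
  by field; rewrite gt_eqF//; clra.
rewrite RintegralZl// /pareto_ddF.
have -> : t `^ (4 - tau) = (t `^ (tau - 4))^-1 by rewrite -powRN opprB.
field; rewrite !gt_eqF ?pareto_mean_gt0 ?powR_gt0//; clra.
Qed.

(** The derivative of [ln (expR y + c)] is affine in [resp c y]; averaging makes the derivative of
    [pareto_lnmean] affine in [pareto_F]. *)
Let exp_resp (y : R) : expR y / (expR y + c) = (1 + c * resp c y) / (c + 1).
Proof. by rewrite /resp; field; rewrite !gt_eqF//; have := expR_gt0 y; clra. Qed.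

Let norm_lnden (a t w : R) : a - 1 < t -> t < a + 1 -> 1 <= w ->
  `|w ^+ 0 * ln (expR (t * w) + c)| <= (ln (1 + c) + `|a| + 2) * w ^+ 2.
Proof.
move=> at_ ta w1; rewrite expr0 mul1r.
have e0 := expR_gt0 (t * w).
rewrite ger0_norm; last by apply: ln_ge0; clra.
have ta1 : `|t| <= `|a| + 1.
  have := ler_norm a; have := ler_norm (- a); rewrite normrN => ? ?.
  by rewrite ler_norml; lra.
apply: (@le_trans _ _ (ln (1 + c) + `|t| * w)).
  have -> : ln (1 + c) + `|t| * w = ln ((1 + c) * expR (`|t| * w)).
    by rewrite lnM ?posrE ?expR_gt0 ?expRK//; clra.
  have c0 : 0 < 1 + c by clra.
  rewrite ler_ln ?posrE ?mulr_gt0 ?expR_gt0//; last by clra.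
  have e1 : expR (t * w) <= expR (`|t| * w).
    by rewrite ler_expR ler_wpM2r ?ler_norm//; lra.
  have e2 : 1 <= expR (`|t| * w).
    by rewrite -expR0 ler_expR mulr_ge0//; lra.
  have : c <= c * expR (`|t| * w) by rewrite ler_peMr//; clra.
  lra.
have l0 : 0 <= ln (1 + c) by apply: ln_ge0; clra.
have := le_sq w1; have := normr_ge0 t; nra.
Qed.

Lemma is_derive_pareto_lnmean (t : R) :
  is_derive t 1 pareto_lnmean (pareto_mean * (1 + c * pareto_F t) / (c + 1)).
Proof.
have h := @is_derive_pareto_integral R tau tau_gt3 _ _ 0 (ln (1 + c) + `|t| + 2)
  (t - 1) (t + 1) t (is_derive_ln_den c_gt1) _ _
  (fun s w us sv w1 => norm_lnden us sv w1).
apply: is_derive_eq; first apply: h; [lra|lra| |].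
- move=> s w us sv w1; rewrite expr1.
  have l0 : 0 <= ln (1 + c) by apply: ln_ge0; clra.
  have e0 := expR_gt0 (s * w).
  have f0 : 0 <= expR (s * w) / (expR (s * w) + c) by rewrite divr_ge0//; clra.
  have f1 : expR (s * w) / (expR (s * w) + c) <= 1.
    by rewrite ler_pdivrMr; clra.
  rewrite ger0_norm; last by rewrite mulr_ge0//; lra.
  have := le_sq w1; have := normr_ge0 t; nra.
rewrite (@eq_Rintegral _ _ _ mu _ (fun w => (c + 1)^-1 * (w * rho w) +
   (c / (c + 1)) * (w ^+ 1 * resp c (t * w) * rho w))); last first.
  by move=> w _; rewrite exp_resp expr1; field; rewrite gt_eqF//; clra.
rewrite RintegralD//; [|exact: integrableZl_fun|exact: integrableZl_fun].
rewrite !RintegralZl// -/pareto_mean /pareto_F; field.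
by rewrite !gt_eqF ?pareto_mean_gt0//; clra.
Qed.

(** The primitive of [pareto_F] vanishing at [0]: [t / c] removes the constant term of that affine
    relation. *)
Definition pareto_Phi (t : R) : R :=
  (c + 1) / (c * pareto_mean) * (pareto_lnmean t - pareto_lnmean 0) - t / c.

Lemma pareto_Phi0 : pareto_Phi 0 = 0.
Proof. by rewrite /pareto_Phi subrr mulr0 mul0r subr0. Qed.

Lemma is_derive_pareto_Phi (t : R) : is_derive t 1 pareto_Phi (pareto_F t).
Proof.
have hd := is_derive_funB
  (is_derive_funM (is_derive_fun_cst ((c + 1) / (c * pareto_mean)) t)
    (is_derive_funB (is_derive_pareto_lnmean t) (is_derive_fun_cst (pareto_lnmean 0) t)))
  (is_derive_funM (is_derive_fun_id t) (is_derive_fun_cst c^-1 t)).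
apply: (is_derive_eq hd); have := pareto_mean_gt0.
move: pareto_mean (pareto_lnmean t) (pareto_lnmean 0) (pareto_F t) => M l l0 F M0; field.
by rewrite !gt_eqF//; clra.
Qed.

End ParetoResponse.

(** * Sign of the second derivative *)

Section SignOfTheSecondDerivative.
Variables (R : realType) (c : R).
Hypothesis c_gt1 : 1 < c.
Local Notation mu := (@lebesgue_measure R).
Local Notation Rpos := (`]0%R, +oo[%classic : set R).
Local Notation L := (ln c).
Local Notation h := (resp2 c).
Local Ltac clra := have ? := c_gt1; have ? := lnc_gt0 c_gt1; lra.

Let L0 : 0 < L. Proof. exact: lnc_gt0. Qed.

Let mRpos : measurable Rpos. Proof. exact: measurable_itv. Qed.

Let Rpos_gt0 (x : R) : Rpos x -> 0 < x.
Proof. by rewrite /= in_itv/= andbT. Qed.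

(* The explicit primitive [(x / (1 + x)) `^ (1 - d)] makes this a convenient
   integrable majorant on the half line. *)
Definition maj (d x : R) : R := (x / (1 + x)) `^ (- d) / (1 + x) ^+ 2.

Let ratio_gt0 (x : R) : 0 < x -> 0 < x / (1 + x).
Proof. by move=> x0; rewrite divr_gt0//; lra. Qed.

Let is_derive_ratio (x : R) : 0 < x ->
  is_derive x 1 (fun y => y / (1 + y)) ((1 + x) ^+ 2)^-1.
Proof.
move=> x0; have x1 : 0 < 1 + x by lra.
have hd := is_derive_funM (is_derive_fun_id x) (@is_derive_funV_pos _ (fun y => 1 + y) _ _ x1
  (is_derive_funD (is_derive_fun_cst 1 x) (is_derive_fun_id x))).
by apply: (is_derive_eq hd); field; rewrite gt_eqF.
Qed.

Lemma maj_ge0 (d x : R) : 0 <= maj d x.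
Proof. by rewrite /maj divr_ge0 ?powR_ge0 ?sqr_ge0. Qed.

Let is_derive_maj_primitive (d x : R) : d < 1 -> 0 < x ->
  is_derive x 1 (fun y => (1 - d)^-1 * (y / (1 + y)) `^ (1 - d)) (maj d x).
Proof.
move=> d1 x0.
have hd := is_derive_funM (is_derive_fun_cst (1 - d)^-1 x)
  (is_derive_fun_comp (is_derive_ratio x0) (is_derive1_powR (1 - d) (ratio_gt0 x0))).
apply: (is_derive_eq hd); rewrite /maj mul0r add0r.
rewrite (_ : 1 - d - 1 = - d); last by ring.
by field; rewrite !gt_eqF//; lra.
Qed.

Let continuous_maj (d x : R) : 0 < x -> {for x, continuous (maj d)}.
Proof.
move=> x0; have x1 : 0 < (1 + x) * (1 + x) by rewrite mulr_gt0//; lra.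
have d1 := is_derive_funD (is_derive_fun_cst 1 x) (is_derive_fun_id x).
have hd := is_derive_funM (is_derive_fun_comp (is_derive_ratio x0)
   (is_derive1_powR (- d) (ratio_gt0 x0)))
  (@is_derive_funV_pos _ (fun y => (1 + y) * (1 + y)) _ _ x1 (is_derive_funM d1 d1)).
exact: is_derive_continuous hd.
Qed.

Let cvg_maj_primitive0 (d : R) : d < 1 ->
  (1 - d)^-1 * (y / (1 + y)) `^ (1 - d) @[y --> 0^'+] --> (0 : R).
Proof.
move=> d1; rewrite -[X in _ --> X](mulr0 (1 - d)^-1); apply: cvgMr.
apply: (@squeeze_cvgr _ _ _ _ (cst 0) (fun y => y `^ (1 - d))).
- near=> y; rewrite powR_ge0/=.
  have y0 : 0 < y by near: y; exact: nbhs_right_gt.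
  apply: ge0_ler_powR; rewrite ?nnegrE.
  + lra.
  + exact/ltW/ratio_gt0.
  + exact: ltW.
  + by rewrite ler_pdivrMr; [nra|lra].
- exact: cvg_cst.
- by apply: powR_cvg0; lra.
Unshelve. all: by end_near. Qed.

Let cvg_maj_primitivey (d : R) : d < 1 ->
  (1 - d)^-1 * (y / (1 + y)) `^ (1 - d) @[y --> +oo%R] --> (1 - d)^-1.
Proof.
move=> d1; rewrite -[X in _ --> X](mulr1 (1 - d)^-1); apply: cvgMr.
have c1 : {for (1 : R), continuous (fun y : R => y `^ (1 - d))}.
  by apply: powR_continuous; lra.
have e1 : (1 : R) `^ (1 - d) = 1 by rewrite powR1.
rewrite -[X in _ --> X]e1.
apply: (@cvg_comp _ _ _ (fun y => y / (1 + y)) (fun y => y `^ (1 - d)) _ (nbhs (1 : R)) _ _ c1).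
apply: (@squeeze_cvgr _ _ _ _ (fun y => 1 - y^-1) (cst 1)).
- near=> y; have y0 : 0 < y by near: y; exact: nbhs_pinfty_gt.
  rewrite /= lerBlDr -subr_ge0; apply/andP; split.
    rewrite (_ : _ - _ = (y * (1 + y))^-1); last by field; rewrite !gt_eqF//; lra.
    by rewrite invr_ge0 mulr_ge0//; lra.
  by rewrite ler_pdivrMr; lra.
- rewrite -[X in _ --> X](subr0 1); apply: cvgB; first exact: cvg_cst.
  have := @cvg_powRN_y R 1 ltr01; apply: cvg_trans; apply: near_eq_cvg.
  near=> y; have y0 : 0 < y by near: y; exact: nbhs_pinfty_gt.
  by rewrite powRN powRr1// ltW.
- exact: cvg_cst.
Unshelve. all: by end_near. Qed.

Lemma integral_maj (d : R) : d < 1 ->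
  (\int[mu]_(x in Rpos) (maj d x)%:E = ((1 - d)^-1)%:E)%E.
Proof.
move=> d1; rewrite (ge0_FTC_itvoy _ _ (fun x x0 => is_derive_maj_primitive d1 x0)
  (cvg_maj_primitive0 d1) (cvg_maj_primitivey d1)) ?subr0//.
- by move=> x _; exact: maj_ge0.
- by move=> x x0; exact: continuous_maj.
Qed.

Lemma integrable_maj (d : R) : d < 1 -> mu.-integrable Rpos (EFin \o maj d).
Proof.
move=> d1; apply: (ge0_FTC_integrable _ _ (fun x x0 => is_derive_maj_primitive d1 x0)
  (cvg_maj_primitive0 d1) (cvg_maj_primitivey d1)).
- by move=> x _; exact: maj_ge0.
- by move=> x x0; exact: continuous_maj.
Qed.

(* The power is normalized at the sign change [ln c] of [resp2 c], which makes
   [wt d x * resp2 c x] nondecreasing in [d] for every [x]. *)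
Definition wt (d x : R) : R := (x / L) `^ (- d).

Lemma wt_gt0 (d x : R) : 0 < x -> 0 < wt d x.
Proof. by move=> x0; rewrite powR_gt0// divr_gt0. Qed.

Lemma wtE (d x : R) : 0 < x -> wt d x = expR (- d * ln (x / L)).
Proof. by move=> x0; rewrite /wt /powR gt_eqF// divr_gt0. Qed.

Lemma wt0 (x : R) : wt 0 x = 1.
Proof. by rewrite /wt oppr0 powRr0. Qed.

Lemma wt_powR (d x : R) : 0 < x -> x `^ (- d) = L `^ (- d) * wt d x.
Proof.
move=> x0; rewrite /wt -powRM ?divr_ge0 ?(ltW x0) ?(ltW L0)//.
by rewrite mulrC mulfVK// gt_eqF.
Qed.

Lemma continuous_wt (d x : R) : 0 < x -> {for x, continuous (wt d)}.
Proof.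
move=> x0; have hd := is_derive_fun_comp
  (is_derive_funM (is_derive_fun_id x) (is_derive_fun_cst L^-1 x))
  (is_derive1_powR (- d) (divr_gt0 x0 L0)).
exact: is_derive_continuous hd.
Qed.

Lemma wt_homo_left (d d' x : R) : 0 < x -> x <= L -> d <= d' -> wt d x <= wt d' x.
Proof.
move=> x0 xL dd; rewrite !wtE// ler_expR ler_wnM2r ?lerN2//.
by apply: ln_le0; rewrite ler_pdivrMr// mul1r.
Qed.

Lemma wt_homo_right (d d' x : R) : L <= x -> d <= d' -> wt d' x <= wt d x.
Proof.
move=> Lx dd; have x0 := lt_le_trans L0 Lx.
rewrite !wtE// ler_expR ler_wpM2r ?lerN2//.
by apply: ln_ge0; rewrite ler_pdivlMr// mul1r.
Qed.

Lemma wt_lt_right (d d' x : R) : L < x -> d < d' -> wt d' x < wt d x.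
Proof.
move=> Lx dd; have x0 := lt_trans L0 Lx.
rewrite !wtE// ltr_expR ltr_pM2r ?ltrN2//.
by apply: ln_gt0; rewrite ltr_pdivlMr// mul1r.
Qed.

Lemma resp2_ge0 (x : R) : x <= L -> 0 <= h x.
Proof.
rewrite le_eqVlt => /predU1P[->|/(resp2_gt0 c_gt1)/ltW//].
by rewrite resp2_lnc.
Qed.

Lemma resp2_le0 (x : R) : L <= x -> h x <= 0.
Proof.
rewrite le_eqVlt => /predU1P[<-|/(resp2_lt0 c_gt1)/ltW//].
by rewrite resp2_lnc.
Qed.

Lemma wt_resp2_homo (d d' x : R) : 0 < x -> d <= d' ->
  wt d x * h x <= wt d' x * h x.
Proof.
move=> x0 dd; have [xL|/ltW Lx] := leP x L.
  by apply: ler_wpM2r; [exact: resp2_ge0|exact: wt_homo_left].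
by apply: ler_wnM2r; [exact: resp2_le0|exact: wt_homo_right].
Qed.

Lemma continuous_wt_resp2 (d x : R) : 0 < x ->
  {for x, continuous (fun x => wt d x * h x)}.
Proof.
move=> x0; apply: continuousM; first exact: continuous_wt.
exact: continuous_resp2.
Qed.

(** Trades the exponential decay for that of [maj], through [1 + x ^ 2 / 2 <= expR x] and
    [(1 + x) ^ 2 <= 2 * (1 + x ^ 2)]. *)
Lemma norm_resp2_le_rational (x : R) : 0 <= x ->
  `|h x| <= 4 * (c + 1) / (1 + x) ^+ 2.
Proof.
move=> x0; apply: le_trans (norm_resp2_le c_gt1 x) _.
apply: le_trans (resp1_le_expN c_gt1 x) _.
rewrite [4 * _]mulrC -mulrA; apply: ler_wpM2l; first by clra.
have x1 : 0 < 1 + x by lra.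
rewrite expRN ler_pdivlMr ?exprn_gt0// mulrC ler_pdivrMr ?expR_gt0//.
have := expR_ge1Dxn 1 x0; rewrite (_ : 2`!%:R = 2)//.
by rewrite !expr2 => ?; have := sqr_ge0 (1 - x); rewrite expr2; lra.
Qed.

Lemma wt_le_ratio (d x : R) : 0 <= d -> 0 < x ->
  wt d x <= L `^ d * (x / (1 + x)) `^ (- d).
Proof.
move=> d0 x0; have x1 : 0 < 1 + x by lra.
have -> : wt d x = L `^ d * x `^ (- d).
  by rewrite (wt_powR d x0) mulrA -powRD_pos// subrr powRr0 mul1r.
apply: ler_wpM2l; first exact: powR_ge0.
rewrite !powRN lef_pV2 ?posrE ?powR_gt0 ?ratio_gt0//.
apply: ge0_ler_powR; rewrite ?nnegrE//.
- exact/ltW/ratio_gt0.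
- exact: ltW.
- by rewrite ler_pdivrMr//; nra.
Qed.

Lemma norm_wt_resp2_le_maj (d x : R) : 0 <= d -> 0 < x ->
  `|wt d x * h x| <= 4 * (c + 1) * L `^ d * maj d x.
Proof.
move=> d0 x0; rewrite normrM [`|wt d x|]ger0_norm ?(ltW (wt_gt0 _ _))//.
have e := wt_le_ratio d0 x0.
apply: le_trans (ler_pM _ _ e (norm_resp2_le_rational (ltW x0))) _.
- exact/ltW/wt_gt0.
- exact: normr_ge0.
- by rewrite le_eqVlt; apply/orP; left; apply/eqP; rewrite /maj; ring.
Qed.

Lemma integrable_wt_resp2 (d : R) : 0 <= d -> d < 1 ->
  mu.-integrable Rpos (EFin \o (fun x => wt d x * h x)).
Proof.
move=> d0 d1.
have ig := integrableZl_fun (4 * (c + 1) * L `^ d) mRpos (integrable_maj d1).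
apply: (dominated_integrable mRpos _ ig).
  by apply: measurable_fun_pos => // x x0; exact: continuous_wt_resp2.
by move=> x /Rpos_gt0 x0; exact: norm_wt_resp2_le_maj.
Qed.

Let mtail (t : R) : measurable (`[t, +oo[%classic : set R).
Proof. exact: measurable_itv. Qed.

Let tail_ge (t x : R) : (`[t, +oo[%classic : set R) x -> t <= x.
Proof. by rewrite /= in_itv/= andbT. Qed.

Let tail_pos (t : R) : 0 < t -> `[t, +oo[ `<=` Rpos.
Proof.
by move=> t0 x /tail_ge tx; rewrite /= in_itv/= andbT (lt_le_trans t0).
Qed.

(** Away from [0] the weight is at most [wt d t], so every [d >= 0] is allowed. This covers [d = 1],
    that is [tau = 4], where the integral down to [0] diverges. *)
Lemma integrable_wt_resp2_tail (d t : R) : 0 <= d -> 0 < t ->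
  mu.-integrable `[t, +oo[ (EFin \o (fun x => wt d x * h x)).
Proof.
move=> d0 t0.
have ih : mu.-integrable `[t, +oo[ (EFin \o (fun x => `|wt 0 x * h x|)).
  apply: integrable_norm.
  exact: (integrable_pos_sub _ (tail_pos t0) (integrable_wt_resp2 (lexx 0) ltr01)).
have ig := integrableZl_fun (wt d t) (mtail t) ih.
apply: (dominated_integrable (mtail t) _ ig).
  apply: (measurable_fun_pos (mtail t) (tail_pos t0)) => x x0.
  exact: continuous_wt_resp2.
move=> x /tail_ge tx; have x0 := lt_le_trans t0 tx.
rewrite wt0 mul1r normrM ger0_norm ?(ltW (wt_gt0 _ _))//.
apply: ler_wpM2r; first exact: normr_ge0.
rewrite !wtE// ler_expR ler_wnM2l ?oppr_le0// ler_ln ?posrE ?divr_gt0//.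
by rewrite ler_pM2r ?invr_gt0.
Qed.

Definition weighted_tail (d t : R) : R := \int[mu]_(x in `[t, +oo[) (wt d x * h x).
Definition weighted_total (d : R) : R := \int[mu]_(x in Rpos) (wt d x * h x).

Lemma weighted_total_homo (d d' : R) : 0 <= d -> d <= d' -> d' < 1 -> weighted_total d <= weighted_total d'.
Proof.
move=> d0 dd d1; apply: le_Rintegral => //.
- by apply: integrable_wt_resp2 => //; exact: le_lt_trans d1.
- by apply: integrable_wt_resp2 => //; exact: le_trans dd.
- by move=> x /Rpos_gt0 x0; exact: wt_resp2_homo.
Qed.

Lemma weighted_tail_lt0_right (d t : R) : 0 <= d -> L <= t -> weighted_tail d t < 0.
Proof.
move=> d0 Lt; have t0 := lt_le_trans L0 Lt.
have intf := integrable_wt_resp2_tail d0 t0.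
rewrite -oppr_gt0 -mulN1r /weighted_tail -RintegralZl//.
apply: (@Rintegral_gt0 R _ _ t (t + 1)) => //.
- exact: integrableZl_fun.
- move=> x /tail_ge tx; rewrite mulN1r oppr_ge0.
  rewrite pmulr_rle0 ?resp2_le0//; first exact: le_trans tx.
  by apply: wt_gt0; exact: lt_le_trans tx.
- lra.
- by move=> x; rewrite /= !in_itv/= andbT => /andP[/ltW].
- move=> x /andP[tx _]; rewrite mulN1r oppr_gt0.
  rewrite pmulr_rlt0 ?resp2_lt0//; first exact: le_lt_trans tx.
  by apply: wt_gt0; exact: lt_trans tx.
Qed.

Lemma weighted_tail_decr (d t t' : R) : 0 <= d -> 0 < t -> t < t' -> t' <= L ->
  weighted_tail d t' < weighted_tail d t.
Proof.
move=> d0 t0 tt' t'L; have intf := integrable_wt_resp2_tail d0 t0.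
have tt'' : (BLeft t <= BLeft t')%O by rewrite bnd_simp ltW.
rewrite /weighted_tail (Rintegral_split intf tt'') ltrDr.
apply: (@Rintegral_gt0 R _ _ t t') => //.
- apply: (integrableS _ _ _ intf) => //.
  by move=> x; rewrite /= !in_itv/= andbT => /andP[].
- move=> x; rewrite /= in_itv/= => /andP[tx xt'].
  rewrite mulr_ge0 ?(ltW (wt_gt0 _ _))//; first exact: lt_le_trans tx.
  by apply: resp2_ge0; rewrite (le_trans (ltW xt')).
- by move=> x; rewrite /= !in_itv/= => /andP[/ltW -> ->].
- move=> x /andP[tx xt']; rewrite mulr_gt0 ?wt_gt0 ?resp2_gt0//.
  + exact: lt_trans tx.
  + exact: lt_le_trans t'L.
Qed.

(** For [t < L] the removed piece over []0, t[] has a positive integrand, so the tail is strictly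
    below the total. Strictness makes the critical exponent itself fall in the negative case. *)
Lemma weighted_tail_lt0 (d : R) : 0 <= d -> d < 1 -> weighted_total d <= 0 ->
  forall t, 0 < t -> weighted_tail d t < 0.
Proof.
move=> d0 d1 Kd t t0; have [Lt|tL] := leP L t; first exact: weighted_tail_lt0_right.
have intf := integrable_wt_resp2 d0 d1.
have t0' : (BRight 0 <= BLeft t)%O by rewrite bnd_simp.
move: Kd; rewrite /weighted_total (Rintegral_split intf t0') -/(weighted_tail d t).
suff : 0 < \int[mu]_(x in [set` Interval (BRight 0) (BLeft t)]) (wt d x * h x) by lra.
apply: (@Rintegral_gt0 R _ _ 0 t) => //.
- apply: (integrableS _ _ _ intf) => //.
  by move=> x; rewrite /= !in_itv/= andbT => /andP[].
- move=> x; rewrite /= in_itv/= => /andP[x0 xt].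
  rewrite mulr_ge0 ?(ltW (wt_gt0 _ _))//.
  by apply: resp2_ge0; rewrite (le_trans (ltW xt)) ?(ltW tL).
- move=> x /andP[x0 xt]; rewrite mulr_gt0 ?wt_gt0 ?resp2_gt0//.
  exact: lt_trans tL.
Qed.

(* Beyond the critical exponent [ds] the tails from [L] on lose a fixed amount
   [eta] of negative mass, while the integral at [ds] itself tends to [0]. *)
Lemma weighted_tail_gt0 (ds d : R) : 0 <= ds -> ds < 1 -> ds < d -> weighted_total ds = 0 ->
  exists t, [/\ 0 < t, t < L & 0 < weighted_tail d t].
Proof.
move=> ds0 ds1 dsd K0; have d0 : 0 <= d by exact/ltW/(le_lt_trans ds0).
pose g (x : R) := wt d x * h x - wt ds x * h x.
have ig (t : R) : 0 < t -> mu.-integrable `[t, +oo[ (EFin \o g).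
  by move=> t0; apply: integrableB_fun => //; exact: integrable_wt_resp2_tail.
have g_ge0 (x : R) : 0 < x -> 0 <= g x.
  by move=> x0; rewrite subr_ge0; apply: wt_resp2_homo => //; exact: ltW.
pose eta := \int[mu]_(x in `[L, +oo[) g x.
have eta0 : 0 < eta.
  apply: (@Rintegral_gt0 R _ _ L (L + 1)) => //.
  - exact: ig.
  - by move=> x /tail_ge Lx; apply: g_ge0; exact: lt_le_trans Lx.
  - lra.
  - by move=> x; rewrite /= !in_itv/= andbT => /andP[/ltW].
  - move=> x /andP[Lx _]; rewrite subr_gt0 ltr_nM2r ?resp2_lt0//.
    exact: wt_lt_right.
have [t [t0 tL ht]] := Rintegral_tail_approx L0 eta0 (integrable_wt_resp2 ds0 ds1).
exists t; split => //; move: ht; rewrite -/(weighted_total ds) K0 sub0r normrN -/(weighted_tail ds t).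
rewrite ltr_norml => /andP[ht _].
suff : eta <= weighted_tail d t - weighted_tail ds t by lra.
rewrite /weighted_tail -RintegralB//; [|exact: integrable_wt_resp2_tail..].
have tL' : (BLeft t <= BLeft L)%O by rewrite bnd_simp ltW.
rewrite -/g (Rintegral_split (ig t t0) tL') lerDr.
apply: Rintegral_ge0 => x; rewrite /= in_itv/= => /andP[tx _].
by apply: g_ge0; exact: lt_le_trans tx.
Qed.

(** The tail is strictly decreasing up to [L] and negative from [L] on. Monotonicity alone makes the
    supremum of the points of positivity the place of the sign change. *)
Lemma weighted_tail_sign_change (ds d : R) : 0 <= ds -> ds < 1 -> ds < d -> weighted_total ds = 0 ->
  exists ts, [/\ 0 < ts, forall t, 0 < t -> t < ts -> 0 < weighted_tail d t &
    forall t, ts < t -> weighted_tail d t < 0].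
Proof.
move=> ds0 ds1 dsd K0; have d0 : 0 <= d by exact/ltW/(le_lt_trans ds0).
have [t0 [t0_gt0 t0L wt0_gt0]] := weighted_tail_gt0 ds0 ds1 dsd K0.
pose A := [set t | [/\ 0 < t, t < L & 0 < weighted_tail d t]].
have supA : has_sup A.
  by split; [exists t0|exists L => t [_ /ltW]].
have supA0 : 0 < sup A.
  by apply: (lt_le_trans t0_gt0); apply: (ub_le_sup supA.2).
exists (sup A); split => //.
- move=> t tpos /(sup_gt supA.1) [s [s0 sL ws] ts].
  by apply: lt_trans ws _; apply: weighted_tail_decr => //; exact: ltW.
- move=> t supt; have [Lt|tL] := leP L t; first exact: weighted_tail_lt0_right.
  (* The tail could vanish just beyond the supremum; comparing with an intermediate point makes the
     inequality strict. *)
  pose m := (sup A + t) / 2.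
  have supm : sup A < m by rewrite /m; lra.
  have mt : m < t by rewrite /m; lra.
  have m0 : 0 < m by lra.
  apply: lt_le_trans (weighted_tail_decr d0 m0 mt (ltW tL)) _.
  rewrite leNgt; apply/negP => wm.
  have : m <= sup A by apply: (ub_le_sup supA.2); split=> //; lra.
  by rewrite leNgt supm.
Qed.

End SignOfTheSecondDerivative.

(** * The critical exponent *)

Section CriticalExponent.
Variables (R : realType) (c : R).
Hypothesis c_gt1 : 1 < c.
Local Notation mu := (@lebesgue_measure R).
Local Notation Rpos := (`]0%R, +oo[%classic : set R).
Local Notation L := (ln c).
Local Notation h := (resp2 c).
Local Notation wt := (wt c).
Local Notation weighted_total := (weighted_total c).
Local Ltac clra := have ? := c_gt1; have ? := lnc_gt0 c_gt1; lra.

Let L0 : 0 < L. Proof. exact: lnc_gt0. Qed.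

Let mRpos : measurable Rpos. Proof. exact: measurable_itv. Qed.

Let Rpos_gt0 (x : R) : Rpos x -> 0 < x.
Proof. by rewrite /= in_itv/= andbT. Qed.

Let continuous_at0 (f : R -> R) (df : R) : is_derive (0 : R) 1 f df ->
  f x @[x --> 0^'+] --> f 0.
Proof. by move=> hf; apply: cvg_at_right_filter; exact: is_derive_continuous hf. Qed.

Let dexpN (x : R) : is_derive x 1 (fun y => - (c + 1) * expR (- y)) ((c + 1) * expR (- x)).
Proof.
have hd := is_derive_funM (is_derive_fun_cst (- (c + 1)) x)
  (is_derive_fun_comp (is_derive_funN (is_derive_fun_id x)) (is_derive_expR (- x))).
by apply: (is_derive_eq hd); ring.
Qed.

Let cvg_expNy : - (c + 1) * expR (- y) @[y --> +oo%R] --> (0 : R).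
Proof. by rewrite -[X in _ --> X](mulr0 (- (c + 1))); apply: cvgMr; exact: cvgr_expR. Qed.

(** The primitive of [h] is [resp1 c], which goes from [1 / (c + 1)] to [0]. As [h] changes sign,
    the nonnegative [e], which dominates [|h|], is added and then subtracted. *)
Lemma weighted_total0 : weighted_total 0 = - (c + 1)^-1.
Proof.
pose e (x : R) := (c + 1) * expR (- x).
have ce (x : R) : {for x, continuous e}.
  have hd := is_derive_funM (is_derive_fun_cst (c + 1) x)
    (is_derive_fun_comp (is_derive_funN (is_derive_fun_id x)) (is_derive_expR (- x))).
  exact: is_derive_continuous hd.
have e0 (x : R) : 0 <= e x by rewrite mulr_ge0 ?expR_ge0//; clra.
have he0 (x : R) : 0 <= h x + e x.
  have := norm_resp2_le c_gt1 x; have := resp1_le_expN c_gt1 x.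
  by have := ler_norm (- h x); rewrite normrN /e; lra.
have che (x : R) : 0 < x -> {for x, continuous (fun x => h x + e x)}.
  by move=> _; apply: continuousD; [exact: continuous_resp2|exact: ce].
have dhe (x : R) : is_derive x 1 (fun y => resp1 c y + - (c + 1) * expR (- y)) (h x + e x).
  exact: is_derive_funD (is_derive_resp1 c_gt1 x) (dexpN x).
have cy : resp1 c y + - (c + 1) * expR (- y) @[y --> +oo%R] --> (0 : R).
  rewrite -[X in _ --> X](addr0 0); apply: cvgD; last exact: cvg_expNy.
  exact: cvg_resp1y.
have i1 := ge0_FTC_itvoy (fun x _ => he0 x) che (fun x _ => dhe x)
  (continuous_at0 (dhe 0)) cy.
have g1 := ge0_FTC_integrable (fun x _ => he0 x) che (fun x _ => dhe x)
  (continuous_at0 (dhe 0)) cy.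
have i2 := ge0_FTC_itvoy (fun x _ => e0 x) (fun x _ => ce x) (fun x _ => dexpN x)
  (continuous_at0 (dexpN 0)) cvg_expNy.
have g2 := ge0_FTC_integrable (fun x _ => e0 x) (fun x _ => ce x) (fun x _ => dexpN x)
  (continuous_at0 (dexpN 0)) cvg_expNy.
rewrite /weighted_total (@eq_Rintegral _ _ _ mu _ (fun x => (h x + e x) - e x)); last first.
  by move=> x _; rewrite wt0 mul1r addrK.
rewrite RintegralB// /Rintegral i1 i2 /= resp1_0// !oppr0 expR0; ring.
Qed.

(** Near [0], [h] is bounded below by a positive constant, so the integrand dominates a multiple of
    [maj d], whose integral is [1 / (1 - d)]. Away from [0] everything is controlled by [maj 0]
    uniformly in [d]. *)
Lemma weighted_total_lower_bound : exists m C : R, 0 < m /\ 0 <= C /\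
  forall d : R, 0 <= d -> d < 1 -> m / (1 - d) - C <= weighted_total d.
Proof.
(* A lower bound for [h] on []0, L / 2]]: there [expR x] is at least [1] and at most [expR (L / 2)],
   and the denominator is at most [(2 * c) ^+ 3]. *)
pose m0 := (c + 1) * (c - expR (L / 2)) / (2 * c) ^+ 3.
have ec : expR L = c by rewrite lnK// posrE; clra.
have e2 : expR (L / 2) < c by rewrite -[ltRHS]ec ltr_expR; clra.
have m00 : 0 < m0.
  rewrite /m0 divr_gt0 ?exprn_gt0 ?mulr_gt0//; clra.
(* [l] bounds [L ^ d] from below for all [d] in [[0, 1)]. *)
pose l := Num.min 1 L; have l0 : 0 < l by rewrite lt_min ltr01 L0.
pose m := m0 * l; have m_gt0 : 0 < m by rewrite mulr_gt0.
(* On [x > L / 2] the first summand pays for the negative part of [h], the second for [m * maj d x],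
   since [(1 + x) / x <= 1 + 2 / L]. *)
pose C := 4 * (c + 1) + m * (1 + 2 / L).
have LV : 0 < L^-1 by rewrite invr_gt0.
have C0 : 0 <= C.
  rewrite /C addr_ge0//; first by clra.
  by rewrite mulr_ge0 ?(ltW m_gt0)//; lra.
exists m, C; split=> //; split=> // d d0 d1.
have im (d' : R) : d' < 1 -> \int[mu]_(x in Rpos) maj d' x = (1 - d')^-1.
  by move=> d'1; rewrite /Rintegral integral_maj.
have -> : m / (1 - d) - C = \int[mu]_(x in Rpos) (m * maj d x - C * maj 0 x).
  rewrite RintegralB//; [|by apply: integrableZl_fun => //; exact: integrable_maj..].
  by rewrite !RintegralZl ?im// ?subr0 ?invr1 ?mulr1//; exact: integrable_maj.
apply: le_Rintegral => //.
- apply: integrableB_fun => //; apply: integrableZl_fun => //; exact: integrable_maj.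
- exact: integrable_wt_resp2.
move=> x /Rpos_gt0 x0; have x1 : 0 < 1 + x by lra.
have maj0E : maj 0 x = ((1 + x) ^+ 2)^-1 by rewrite /maj oppr0 powRr0 mul1r.
have M0 : 0 <= C * maj 0 x by rewrite mulr_ge0 ?maj_ge0.
have majE : maj d x = x `^ (- d) * (1 + x) `^ d / (1 + x) ^+ 2.
  rewrite /maj powRM ?invr_ge0 ?(ltW x0) ?(ltW x1)//.
  by rewrite -[(1 + x)^-1]powR_inv1 ?(ltW x1)// -powRrM mulrNN mul1r.
have [xL|Lx] := leP x (L / 2).
  have hm : m0 <= h x.
    have ex : expR x <= expR (L / 2) by rewrite ler_expR.
    have e1 : 1 <= expR x by rewrite -expR0 ler_expR ltW.
    rewrite /m0 /resp2; apply: ler_pM.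
    - by rewrite mulr_ge0//; clra.
    - by rewrite invr_ge0 exprn_ge0//; clra.
    - rewrite ler_pM2l; last by clra.
      apply: (@le_trans _ _ (c - expR x)); first by lra.
      by rewrite ler_peMl//; lra.
    - rewrite lef_pV2 ?posrE ?exprn_gt0//; [|by clra..].
      by apply: lerXn2r; rewrite ?nnegrE; clra.
  apply: (@le_trans _ _ (m * maj d x)); first by lra.
  have majle : maj d x <= x `^ (- d).
    rewrite majE -mulrA ler_piMr ?powR_ge0// ler_pdivrMr ?exprn_gt0// mul1r.
    rewrite -powR_mulrn ?(ltW x1)//; apply: ler_powR; first by lra.
    by rewrite (le_trans (ltW d1))// ler1n.
  have wtx : wt d x = L `^ d * x `^ (- d).
    by rewrite (wt_powR c_gt1 d x0) mulrA -powRD_pos// subrr powRr0 mul1r.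
  have ll : l <= L `^ d.
    have [L1|L1] := leP 1 L.
      apply: (@le_trans _ _ 1); first by rewrite ge_min lexx.
      by rewrite -[leLHS](powRr0 L); apply: ler_powR.
    apply: (@le_trans _ _ L); first by rewrite ge_min lexx orbT.
    by apply: ger1_powR; [rewrite L0 ltW|exact: ltW].
  rewrite wtx /m -mulrA [leRHS]mulrC.
  apply: ler_pM => //; [exact: ltW|by rewrite mulr_ge0 ?maj_ge0// ltW|].
  by apply: ler_pM => //; [exact: ltW|exact: maj_ge0].
have majle : maj d x <= (1 + 2 / L) * maj 0 x.
  rewrite /maj oppr0 powRr0 mul1r ler_pM2r ?invr_gt0 ?exprn_gt0//.
  have -> : (x / (1 + x)) `^ (- d) = ((1 + x) / x) `^ d.
    rewrite -invf_div -[((1 + x) / x)^-1]powR_inv1 ?divr_ge0 ?(ltW x0) ?(ltW x1)//.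
    by rewrite -powRrM mulN1r opprK.
  apply: (@le_trans _ _ ((1 + x) / x)).
    apply: ler1_powR; last exact: ltW.
    by rewrite ler_pdivlMr//; lra.
  rewrite mulrDl mul1r mulfV ?gt_eqF// addrC lerD2l.
  by rewrite -[leRHS]invf_div lef_pV2 ?posrE ?ltW// divr_gt0.
have hle : - (4 * (c + 1) * maj 0 x) <= wt d x * h x.
  have [xL|/ltW xL] := leP x L.
    apply: (@le_trans _ _ 0).
      by rewrite oppr_le0 mulr_ge0 ?maj_ge0//; clra.
    by rewrite mulr_ge0 ?(ltW (wt_gt0 c_gt1 _ _)) ?resp2_ge0.
  rewrite lerNl -mulrN -[- h x]ler0_norm; last exact: resp2_le0.
  have w1 : wt d x <= 1 by rewrite -(wt0 c x); exact: wt_homo_right.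
  have := norm_resp2_le_rational c_gt1 (ltW x0); rewrite -maj0E.
  apply: le_trans; rewrite -[leRHS]mul1r; apply: ler_wpM2r => //.
have : m * maj d x <= m * ((1 + 2 / L) * maj 0 x) by rewrite ler_pM2l.
rewrite /C mulrA mulrDl; lra.
Qed.

(** The even extension [|d|] makes [0] an interior point of the parameter interval. Domination holds
    because [wt |d| x] lies between [wt 0 x] and [wt v x], hence below their sum. *)
Lemma continuous_weighted_total (v : R) : 0 < v -> v < 1 ->
  forall d : R, - v < d -> d < v -> {for d, continuous (fun d => weighted_total `|d|)}.
Proof.
move=> v0 v1 d0 vd dv.
pose f (d x : R) := wt `|d| x * h x.
have If (d : R) : `]- v, v[%classic d -> `|d| < v.
  by rewrite /= in_itv/= ltr_norml.
have intf (d : R) : `]- v, v[%classic d -> mu.-integrable Rpos (EFin \o f d).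
  by move=> /If dv'; apply: integrable_wt_resp2 => //; exact: lt_trans v1.
pose g (x : R) := `|wt 0 x * h x| + `|wt v x * h x|.
have intg : mu.-integrable Rpos (EFin \o g).
  apply: integrableD_fun => //; apply: integrable_norm => //.
    exact: integrable_wt_resp2.
  by apply: integrable_wt_resp2 => //; exact: ltW.
have gub (d : R) : `]- v, v[%classic d ->
    {ae mu, forall x, Rpos x -> `|f d x| <= g x}.
  move=> /If dv'; apply: aeW => x /Rpos_gt0 x0.
  rewrite /f /g !(normrM _ (h x)) -mulrDl; apply: ler_wpM2r; first exact: normr_ge0.
  rewrite !(ger0_norm (ltW (wt_gt0 c_gt1 _ x0))).
  have w0 := wt_gt0 c_gt1 0 x0; have wv := wt_gt0 c_gt1 v x0.
  have [xL|/ltW Lx] := leP x L.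
    by have := wt_homo_left c_gt1 x0 xL (ltW dv'); lra.
  by have := wt_homo_right c_gt1 Lx (normr_ge0 d); lra.
have cf : {ae mu, forall x, Rpos x -> {in `]- v, v[%classic, continuous (f ^~ x)}}.
  apply: aeW => x /Rpos_gt0 x0 d _.
  have -> : f ^~ x = (fun d : R => expR (- `|d| * ln (x / L)) * h x).
    by apply/funext => d'; rewrite /f wtE.
  have cn : {for d, continuous (fun d : R => `|d|)} by exact: norm_continuous.
  have ce : {for d, continuous (fun d : R => expR (- `|d| * ln (x / L)))}.
    apply: (@continuous_comp _ _ _ (fun d : R => - `|d| * ln (x / L)) expR); last exact: continuous_expR.
    by apply: cvgM; [exact: cvgN|exact: cvg_cst].
  by apply: cvgM; [exact: ce|exact: cvg_cst].
apply: (@continuity_under_integral R _ _ mu f Rpos mRpos (- v) v intf cf g intg gub d0).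
by rewrite inE/= in_itv/= vd dv.
Qed.

Lemma weighted_total_zero : exists d : R, [/\ 0 < d, d < 1 & weighted_total d = 0].
Proof.
have [m [C [m0 [C0 hK]]]] := weighted_total_lower_bound.
(* Chosen so that [m / (1 - d) = C + m], which leaves a lower bound [m > 0]. *)
pose d := C / (C + m).
have Cm : 0 < C + m by lra.
have d0 : 0 <= d by rewrite divr_ge0// ltW.
have d1 : d < 1 by rewrite ltr_pdivrMr//; lra.
have Kd : 0 < weighted_total d.
  apply: lt_le_trans (hK _ d0 d1).
  have -> : 1 - d = m / (C + m) by rewrite /d; field; rewrite gt_eqF.
  by rewrite invf_div mulrCA mulfV ?mulr1 ?gt_eqF//; lra.
have K0 : weighted_total 0 < 0 by rewrite weighted_total0 oppr_lt0 invr_gt0; clra.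
have [v v0 [dv v1]] : exists2 v, 0 < v & d < v /\ v < 1.
  by exists ((d + 1) / 2); [lra|split; lra].
have [||z] := @IVT R (fun d => weighted_total `|d|) 0 d 0 d0.
- apply: continuous_in_subspaceT => x; rewrite inE/= in_itv/= => /andP[x0 xd].
  by apply: (continuous_weighted_total v0 v1); lra.
- by rewrite normr0 ger0_norm// ge_min le_max (ltW K0) (ltW Kd) orbT.
rewrite in_itv/= => /andP[z0 zd]; rewrite ger0_norm// => Kz.
exists z; split => //; last exact: le_lt_trans d1.
rewrite lt_neqAle z0 andbT; apply/eqP => z00.
by move: K0; rewrite [X in weighted_total X]z00 Kz ltxx.
Qed.

End CriticalExponent.

(** * Asymptotics of the critical exponent *)

Section CriticalExponentAsymptotics.
Variables (R : realType) (c : R).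
Hypothesis c_gt1 : 1 < c.
Local Notation mu := (@lebesgue_measure R).
Local Notation Rpos := (`]0%R, +oo[%classic : set R).
Local Notation L := (ln c).
Local Notation h := (resp2 c).
Local Notation wt := (wt c).
Local Notation weighted_total := (weighted_total c).
Local Ltac clra := have ? := c_gt1; have ? := lnc_gt0 c_gt1; lra.

Let L0 : 0 < L. Proof. exact: lnc_gt0. Qed.

Let mRpos : measurable Rpos. Proof. exact: measurable_itv. Qed.

Let Rpos_gt0 (x : R) : Rpos x -> 0 < x.
Proof. by rewrite /= in_itv/= andbT. Qed.

Let expL : expR L = c.
Proof. by rewrite lnK// posrE; clra. Qed.

Let sq_le_exp (u : R) : u ^+ 2 <= 8 * (expR (u / 2) + expR (- (u / 2))).
Proof.
have w0 : 0 <= `|u / 2| by [].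
have := expR_ge1Dxn 1 w0; rewrite (_ : 2`!%:R = 2)// real_normK ?num_real//.
have hm : expR `|u / 2| <= expR (u / 2) + expR (- (u / 2)).
  have := expR_ge0 (u / 2); have := expR_ge0 (- (u / 2)).
  by case: ler0P => _; lra.
by rewrite !expr2; lra.
Qed.

Let sqrtc : R := expR (L / 2).

Let sqrtc_gt1 : 1 < sqrtc.
Proof. by rewrite /sqrtc expR_gt1 divr_gt0. Qed.

(** A bump centred at [L] like [|h|], but with half its exponential rate; the other half pays for
    the factor [(x - L) ^+ 2]. Its primitive is explicit and its integral is [2] for every [c]. *)
Let maj2 (x : R) : R := resp1 sqrtc (x / 2).

Let maj2_ge0 (x : R) : 0 <= maj2 x.
Proof. exact/ltW/resp1_gt0. Qed.

Let is_derive_maj2 (x : R) : is_derive x 1 (fun y => 2 * resp sqrtc (y / 2)) (maj2 x).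
Proof.
have hd := is_derive_funM (is_derive_fun_cst 2 x) (is_derive_fun_comp
  (is_derive_funM (is_derive_fun_id x) (is_derive_fun_cst 2^-1 x))
  (is_derive_resp sqrtc_gt1 (x / 2))).
by apply: (is_derive_eq hd); rewrite /maj2; field.
Qed.

Let continuous_maj2 (x : R) : {for x, continuous maj2}.
Proof.
have hd := is_derive_fun_comp
  (is_derive_funM (is_derive_fun_id x) (is_derive_fun_cst 2^-1 x))
  (is_derive_resp1 sqrtc_gt1 (x / 2)).
exact: is_derive_continuous hd.
Qed.

Let cvg_maj2_0 : 2 * resp sqrtc (y / 2) @[y --> 0^'+] --> (0 : R).
Proof.
have := cvg_at_right_filter (is_derive_continuous (is_derive_maj2 0)).
by rewrite mul0r resp0 mulr0.
Qed.

Let cvg_maj2_y : 2 * resp sqrtc (y / 2) @[y --> +oo%R] --> (2 : R).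
Proof.
rewrite -[X in _ --> X](mulr1 2); apply: cvgMr.
apply: (@cvg_comp _ _ _ (fun y : R => y / 2) (resp sqrtc) _ +oo%R); last exact: cvg_respy.
by apply: gt0_cvgMly => //; rewrite invr_gt0.
Qed.

Let int_maj2 : \int[mu]_(x in Rpos) maj2 x = 2.
Proof.
rewrite /Rintegral (ge0_FTC_itvoy (fun x _ => maj2_ge0 x) (fun x _ => @continuous_maj2 x)
  (fun x _ => is_derive_maj2 x) cvg_maj2_0 cvg_maj2_y).
by rewrite subr0.
Qed.

Let integrable_maj2 : mu.-integrable Rpos (EFin \o maj2).
Proof.
exact: (ge0_FTC_integrable (fun x _ => maj2_ge0 x) (fun x _ => @continuous_maj2 x)
  (fun x _ => is_derive_maj2 x) cvg_maj2_0 cvg_maj2_y).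
Qed.

(** In the variables [a = expR (x / 2)] and [sqrtc] the claim is rational. It follows from [(a +
    sqrtc) ^+ 2 <= 2 * (a * a + sqrtc * sqrtc)] and [sqrtc > 1]. *)
Let second_moment_le (x : R) : (x - L) ^+ 2 * `|h x| <= 32 * maj2 x.
Proof.
pose a : R := expR (x / 2); have a0 : 0 < a by exact: expR_gt0.
have s1 := sqrtc_gt1; have s0 : 0 < sqrtc by exact: expR_gt0.
have ex : expR x = a * a by rewrite /a -expRD; congr expR; lra.
have ec : c = sqrtc * sqrtc by rewrite /sqrtc -expRD -[LHS]expL; congr expR; lra.
have usq : (x - L) ^+ 2 <= 8 * ((a * a + sqrtc * sqrtc) / (a * sqrtc)).
  apply: le_trans (sq_le_exp _) _.
  have -> : expR ((x - L) / 2) = a / sqrtc.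
    by rewrite /a /sqrtc -expRN -expRD; congr expR; lra.
  have -> : expR (- ((x - L) / 2)) = sqrtc / a.
    by rewrite /a /sqrtc -expRN -expRD; congr expR; lra.
  rewrite le_eqVlt; apply/orP; left; apply/eqP; field.
  by rewrite !gt_eqF.
have hle := norm_resp2_le c_gt1 x.
apply: le_trans (ler_pM (sqr_ge0 _) (normr_ge0 _) usq hle) _.
rewrite /resp1 /maj2 /resp1 -/a ex ec.
have as0 : 0 < a + sqrtc by lra.
have q0 : 0 < a * a + sqrtc * sqrtc by rewrite addr_gt0// mulr_gt0.
rewrite -subr_ge0.
rewrite (_ : _ - _ = 8 * a * (4 * (sqrtc + 1) * sqrtc * (a * a + sqrtc * sqrtc) -
   (sqrtc * sqrtc + 1) * (a + sqrtc) ^+ 2) / (sqrtc * (a * a + sqrtc * sqrtc) * (a + sqrtc) ^+ 2)); last first.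
  by field; rewrite !gt_eqF.
apply: divr_ge0; last by rewrite !mulr_ge0 ?sqr_ge0 ?ltW.
apply: mulr_ge0; first by lra.
rewrite subr_ge0.
have h1 : (a + sqrtc) ^+ 2 <= 2 * (a * a + sqrtc * sqrtc).
  by have := sqr_ge0 (a - sqrtc); rewrite !expr2; lra.
apply: (@le_trans _ _ ((sqrtc * sqrtc + 1) * (2 * (a * a + sqrtc * sqrtc)))).
  by apply: ler_wpM2l => //; rewrite addr_ge0// mulr_ge0// ltW.
rewrite mulrA ler_pM2r//; nra.
Qed.

Let cvg_x_resp1 : x * resp1 c x @[x --> +oo%R] --> (0 : R).
Proof.
have inv_y : y^-1 @[y --> +oo%R] --> (0 : R).
  have := @cvg_powRN_y R 1 ltr01; apply: cvg_trans; apply: near_eq_cvg.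
  near=> y; have y0 : 0 < y by near: y; exact: nbhs_pinfty_gt.
  by rewrite powRN powRr1// ltW.
apply: (@squeeze_cvgr _ _ _ _ (cst 0) (fun x => 2 * (c + 1) * x^-1)).
- near=> x; have x0 : 0 < x by near: x; exact: nbhs_pinfty_gt.
  rewrite /= mulr_ge0 ?(ltW x0) ?(ltW (resp1_gt0 c_gt1 _))//=.
  apply: le_trans (ler_wpM2l (ltW x0) (resp1_le_expN c_gt1 x)) _.
  rewrite mulrCA [2 * _]mulrC -mulrA ler_pM2l; last by clra.
  rewrite expRN ler_pdivrMr ?expR_gt0// mulrAC ler_pdivlMr//.
  by have := expR_ge1Dxn 1 (ltW x0); rewrite (_ : 2`!%:R = 2)// !expr2; lra.
- exact: cvg_cst.
- by rewrite -[X in _ --> X](mulr0 (2 * (c + 1))); apply: cvgMr.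
Unshelve. all: by end_near. Qed.

(** The derivative in [d] at [0] of the weighted integrand, multiplied by [L] and with [ln (x / L)]
    linearized at [x = L]. It is nonnegative since [h] changes sign at [L]. *)
Let mom (x : R) : R := - (x - L) * h x.

Let mom_ge0 (x : R) : 0 <= mom x.
Proof.
rewrite /mom; have [xL|/ltW Lx] := leP x L.
  by rewrite mulr_ge0 ?resp2_ge0//; lra.
by rewrite mulr_le0 ?resp2_le0//; lra.
Qed.

Let is_derive_mom (x : R) :
  is_derive x 1 (fun y => - (y - L) * resp1 c y + resp c y) (mom x).
Proof.
have hd := is_derive_funD (is_derive_funM (is_derive_funN
    (is_derive_funB (is_derive_fun_id x) (is_derive_fun_cst L x)))
  (is_derive_resp1 c_gt1 x)) (is_derive_resp c_gt1 x).
by apply: (is_derive_eq hd); rewrite /mom; ring.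
Qed.

Let continuous_mom (x : R) : {for x, continuous mom}.
Proof.
apply: cvgM; last exact: continuous_resp2.
by apply: cvgN; apply: cvgB; [exact: cvg_id|exact: cvg_cst].
Qed.

Let cvg_mom0 : - (y - L) * resp1 c y + resp c y @[y --> 0^'+] --> (L / (c + 1) : R).
Proof.
have := cvg_at_right_filter (is_derive_continuous (is_derive_mom 0)).
by rewrite sub0r opprK resp0 addr0 resp1_0.
Qed.

Let cvg_momy : - (y - L) * resp1 c y + resp c y @[y --> +oo%R] --> (1 : R).
Proof.
rewrite -[X in _ --> X](add0r 1); apply: cvgD; last exact: cvg_respy.
rewrite (_ : (fun y => _) = (fun y => L * resp1 c y - y * resp1 c y)); last first.
  by apply/funext => y; ring.
rewrite -[X in _ --> X](subr0 0); apply: cvgB; last exact: cvg_x_resp1.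
by rewrite -[X in _ --> X](mulr0 L); apply: cvgMr; exact: cvg_resp1y.
Qed.

Let int_mom : \int[mu]_(x in Rpos) mom x = 1 - L / (c + 1).
Proof.
by rewrite /Rintegral (ge0_FTC_itvoy (fun x _ => mom_ge0 x) (fun x _ => @continuous_mom x)
  (fun x _ => is_derive_mom x) cvg_mom0 cvg_momy).
Qed.

Let integrable_mom : mu.-integrable Rpos (EFin \o mom).
Proof.
exact: (ge0_FTC_integrable (fun x _ => mom_ge0 x) (fun x _ => @continuous_mom x)
  (fun x _ => is_derive_mom x) cvg_mom0 cvg_momy).
Qed.

(* Convexity of [expR], from its tangent at [t * v]. *)
Let exp_chord (t v : R) : 0 <= t -> t <= 1 -> expR (t * v) <= 1 + t * (expR v - 1).
Proof.
move=> t0 t1.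
have e0 := expR_gt0 (t * v).
have h1 : expR (t * v) * (1 + (1 - t) * v) <= expR v.
  rewrite [leRHS](_ : _ = expR (t * v) * expR ((1 - t) * v)); last first.
    by rewrite -expRD; congr expR; ring.
  by rewrite ler_pM2l// expR_ge1Dx.
have h2 : expR (t * v) * (1 - t * v) <= 1.
  rewrite [leRHS](_ : 1 = expR (t * v) * expR (- (t * v))); last first.
    by rewrite -expRD subrr expR0.
  by rewrite ler_pM2l// expR_ge1Dx.
have h3 := ler_wpM2l t0 h1.
have h4 : (1 - t) * (expR (t * v) * (1 - t * v)) <= (1 - t) * 1.
  by apply: ler_wpM2l => //; lra.
have -> : expR (t * v) = t * (expR (t * v) * (1 + (1 - t) * v)) +
    (1 - t) * (expR (t * v) * (1 - t * v)) by ring.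
lra.
Qed.

Let wtB1 (x : R) (d : R) : wt d x * h x - h x = (wt d x - 1) * h x.
Proof. ring. Qed.

(** Write [y = x / L]. Left of [L], [wt d x - 1 >= - d * ln y >= d * (1 - y)] suffices. Right of
    [L], the chord bound gives [1 - wt d x >= d * (1 - y^-1)], and
    [1 - y^-1 >= (y - 1) - (y - 1) ^+ 2] leaves a second-moment error. *)
Let lower_pointwise (d x : R) : 0 <= d -> d <= 1 -> 0 < x ->
  d / L * mom x - 32 * d / L ^+ 2 * maj2 x <= (wt d x - 1) * h x.
Proof.
move=> d0 d1 x0; have y0 : 0 < x / L by rewrite divr_gt0.
apply: (@le_trans _ _ (d / L * mom x - d / L ^+ 2 * ((x - L) ^+ 2 * `|h x|))).
  have B0 : 0 <= d / L ^+ 2 by rewrite divr_ge0 ?sqr_ge0.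
  rewrite [32 * d / L ^+ 2 * _](_ : _ = d / L ^+ 2 * (32 * maj2 x)); last by ring.
  by rewrite lerD2l lerN2 ler_wpM2l// second_moment_le.
have yE : ln (x / L) <= x / L - 1.
  by have := @le_ln1Dx R (x / L - 1); rewrite subrKC; apply; lra.
have [xL|/ltW Lx] := leP x L.
  have h0 := resp2_ge0 c_gt1 xL.
  apply: (@le_trans _ _ (d / L * mom x)).
    rewrite gerBl mulr_ge0 ?divr_ge0 ?sqr_ge0// mulr_ge0 ?sqr_ge0//.
  have -> : d / L * mom x = d * (1 - x / L) * h x.
    by rewrite /mom; field; rewrite gt_eqF.
  apply: ler_wpM2r => //.
  rewrite wtE//; have := expR_ge1Dx (- d * ln (x / L)).
  have : d * (1 - x / L) <= - d * ln (x / L).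
    by rewrite mulNr -mulrN ler_wpM2l//; lra.
  lra.
have h0 := resp2_le0 c_gt1 Lx.
rewrite (ler0_norm h0).
have -> : d / L * mom x - d / L ^+ 2 * ((x - L) ^+ 2 * - h x) =
   d * ((x / L - 1) - (x / L - 1) ^+ 2) * - h x.
  by rewrite /mom; field; rewrite gt_eqF.
have -> : (wt d x - 1) * h x = (1 - wt d x) * - h x by ring.
apply: ler_wpM2r; first by lra.
have wle : wt d x <= 1 + d * ((x / L)^-1 - 1).
  rewrite wtE//.
  have -> : - d * ln (x / L) = d * - ln (x / L) by ring.
  apply: le_trans (exp_chord _ d0 d1) _.
  by rewrite expRN lnK.
have yle : (x / L - 1) - (x / L - 1) ^+ 2 <= 1 - (x / L)^-1.
  rewrite -subr_ge0.
  have -> : 1 - (x / L)^-1 - (x / L - 1 - (x / L - 1) ^+ 2) =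
     (x / L - 1) ^+ 2 * (x / L - 1) / (x / L) by field; rewrite !gt_eqF.
  rewrite divr_ge0 ?(ltW y0)// mulr_ge0 ?sqr_ge0// subr_ge0.
  by rewrite ler_pdivlMr// mul1r.
have := ler_wpM2l d0 yle; lra.
Qed.

(** A bound on [2 * (1 + L) ^+ 5 * expR (- (3 * L / 4))] that is uniform in [L], from
    [1 + L <= 20 / 3 * expR (3 * L / 20)]. *)
Let K5 : R := 2 * (20 / 3) ^+ 5.

(** From [L / 4] to [L] the weight is at most [2] and [second_moment_le] applies. Left of [L / 4]
    the weight is singular, but [h x <= 2 * expR (- (3 * L / 4))]: this absorbs two powers of
    [1 + L] from the square and three from comparing the weight with [maj (1 / 2)]. *)
Let half_moment_le (x : R) : 0 < x -> x <= L ->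
  (x - L) ^+ 2 * wt (1 / 2) x * h x <= 64 * maj2 x + K5 * maj (1 / 2) x.
Proof.
move=> x0 xL; have h0 := resp2_ge0 c_gt1 xL.
have w0 := wt_gt0 c_gt1 (1 / 2) x0.
have sm := second_moment_le x; rewrite (ger0_norm h0) in sm.
have M0 := maj2_ge0 x; have M1 := maj_ge0 (1 / 2) x.
have K0 : 0 <= K5 by rewrite /K5 mulr_ge0// exprn_ge0//; lra.
have [Lx|xL4] := leP (L / 4) x.
  have w2 : wt (1 / 2) x <= 2.
    apply: (@le_trans _ _ (wt (1 / 2) (L / 4))).
      rewrite !wtE ?divr_gt0// ler_expR; apply: ler_wnM2l; first by lra.
      by rewrite ler_ln ?posrE ?divr_gt0// ler_pM2r ?invr_gt0.
    rewrite wtE ?divr_gt0// [L / 4 / L](_ : _ = (2 * 2)^-1); last by field; rewrite gt_eqF.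
    rewrite lnV ?posrE// lnM ?posrE// [- (1 / 2) * _](_ : _ = ln 2); last by field.
    by rewrite lnK ?posrE.
  have -> : (x - L) ^+ 2 * wt (1 / 2) x * h x = wt (1 / 2) x * ((x - L) ^+ 2 * h x) by ring.
  have g0 : 0 <= (x - L) ^+ 2 * h x by rewrite mulr_ge0 ?sqr_ge0.
  have := ler_wpM2r g0 w2; have := mulr_ge0 K0 M1; lra.
have x1 : 0 < 1 + x by lra.
have L1 : 0 < 1 + L by clra.
have hx : h x <= 2 * expR (- (3 * L / 4)).
  have := norm_resp2_le c_gt1 x; rewrite (ger0_norm h0) => /le_trans; apply.
  have e0 := expR_gt0 x.
  apply: (@le_trans _ _ ((c + 1) * expR x / c ^+ 2)).
    rewrite /resp1 ler_wpM2l//; first by rewrite mulr_ge0 ?ltW//; clra.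
    rewrite lef_pV2 ?posrE ?exprn_gt0//; [|clra|clra].
    by apply: lerXn2r; rewrite ?nnegrE; clra.
  apply: (@le_trans _ _ (2 * (expR x / c))).
    rewrite -subr_ge0.
    have -> : 2 * (expR x / c) - (c + 1) * expR x / c ^+ 2 = expR x * (c - 1) / c ^+ 2.
      by field; rewrite gt_eqF//; clra.
    by rewrite divr_ge0 ?sqr_ge0// mulr_ge0 ?ltW//; clra.
  rewrite ler_pM2l// -{1}expL -expRN -expRD ler_expR; lra.
have wx : wt (1 / 2) x <= (1 + L) ^+ 3 * maj (1 / 2) x.
  have half0 : 0 <= 1 / 2 :> R by lra.
  apply: le_trans (wt_le_ratio c_gt1 half0 x0) _.
  have -> : (x / (1 + x)) `^ (- (1 / 2)) = (1 + x) ^+ 2 * maj (1 / 2) x.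
    by rewrite /maj; field; rewrite gt_eqF.
  rewrite [(1 + L) ^+ 3]exprS -[leRHS]mulrA.
  have LL : L `^ (1 / 2) <= 1 + L.
    apply: (@le_trans _ _ ((1 + L) `^ (1 / 2))).
      by apply: ge0_ler_powR; rewrite ?nnegrE; clra.
    by apply: ler1_powR; clra.
  apply: ler_pM => //; [exact: powR_ge0|by rewrite mulr_ge0 ?sqr_ge0|].
  apply: ler_wpM2r => //; apply: lerXn2r; rewrite ?nnegrE; clra.
have u2 : (x - L) ^+ 2 <= (1 + L) ^+ 2.
  rewrite -[leLHS]sqrrN; apply: lerXn2r; rewrite ?nnegrE; clra.
have e5 : (1 + L) ^+ 5 * expR (- (3 * L / 4)) <= (20 / 3) ^+ 5.
  have e1 : 1 + L <= 20 / 3 * expR (3 * L / 20).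
    by have := expR_ge1Dx (3 * L / 20); clra.
  rewrite expRN ler_pdivrMr ?expR_gt0//.
  have -> : expR (3 * L / 4) = expR (3 * L / 20) ^+ 5.
    by rewrite -expRM_natl; congr expR; field.
  have e3 := expR_gt0 (3 * L / 20).
  by rewrite -exprMn; apply: lerXn2r; rewrite ?nnegrE//; clra.
have p1 := ler_pM (sqr_ge0 _) (ltW w0) u2 wx.
have p2 := ler_pM (mulr_ge0 (sqr_ge0 _) (ltW w0)) h0 p1 hx.
apply: le_trans p2 _.
rewrite [leLHS](_ : _ = 2 * ((1 + L) ^+ 5 * expR (- (3 * L / 4))) * maj (1 / 2) x); last by ring.
have := ler_wpM2r M1 e5; rewrite /K5; lra.
Qed.

(** Left of [L], the chord bound with ratio [2 * d] reduces all exponents [d <= 1 / 2] to [1 / 2],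
    and the substitution [z = (x / L) ^ (1 / 2)] makes the remaining inequality algebraic. Right of
    [L], [wt d x - 1 >= - d * (x / L - 1)] is multiplied by [h x <= 0]. *)
Let upper_pointwise (d x : R) : 0 <= d -> d <= 1 / 2 -> 0 < x ->
  (wt d x - 1) * h x <=
  d / L * mom x + 2 * d / L ^+ 2 * (64 * maj2 x + K5 * maj (1 / 2) x).
Proof.
move=> d0 d1 x0; have y0 : 0 < x / L by rewrite divr_gt0.
have M0 := maj2_ge0 x; have M1 := maj_ge0 (1 / 2) x.
have K0 : 0 <= K5 by rewrite /K5 mulr_ge0// exprn_ge0//; lra.
have B0 : 0 <= 2 * d / L ^+ 2 by rewrite divr_ge0 ?sqr_ge0//; lra.
have yE : ln (x / L) <= x / L - 1.
  by have := @le_ln1Dx R (x / L - 1); rewrite subrKC; apply; lra.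
have [xL|/ltW Lx] := leP x L; last first.
  have h0 := resp2_le0 c_gt1 Lx.
  apply: (@le_trans _ _ (d / L * mom x)); last first.
    by rewrite lerDl mulr_ge0// addr_ge0// mulr_ge0.
  have -> : d / L * mom x = - (d * (x / L - 1)) * h x.
    by rewrite /mom; field; rewrite gt_eqF.
  apply: ler_wnM2r => //.
  rewrite wtE//; have := expR_ge1Dx (- d * ln (x / L)).
  have := ler_wpM2l d0 yE; lra.
have h0 := resp2_ge0 c_gt1 xL.
apply: (@le_trans _ _ (d / L * mom x + 2 * d / L ^+ 2 *
    ((x - L) ^+ 2 * wt (1 / 2) x * h x))); last first.
  by rewrite lerD2l ler_wpM2l// half_moment_le.
have -> : d / L * mom x + 2 * d / L ^+ 2 * ((x - L) ^+ 2 * wt (1 / 2) x * h x) =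
   (d * (1 - x / L) + 2 * d * ((1 - x / L) ^+ 2 * wt (1 / 2) x)) * h x.
  by rewrite /mom; field; rewrite gt_eqF.
apply: ler_wpM2r => //.
have wle : wt d x - 1 <= 2 * d * (wt (1 / 2) x - 1).
  rewrite !wtE//.
  have -> : - d * ln (x / L) = (2 * d) * (- (1 / 2) * ln (x / L)) by field.
  have d20 : 0 <= 2 * d by lra.
  have d21 : 2 * d <= 1 by lra.
  have := exp_chord (- (1 / 2) * ln (x / L)) d20 d21; lra.
apply: le_trans wle _.
have -> : d * (1 - x / L) + 2 * d * ((1 - x / L) ^+ 2 * wt (1 / 2) x) =
   2 * d * ((1 - x / L) / 2 + (1 - x / L) ^+ 2 * wt (1 / 2) x).
  by field; rewrite gt_eqF.
apply: ler_wpM2l; first by lra.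
pose z : R := expR (1 / 2 * ln (x / L)).
have z0 : 0 < z by exact: expR_gt0.
have wz : wt (1 / 2) x = z^-1 by rewrite wtE// /z -expRN mulNr.
have yz : x / L = z * z.
  rewrite /z -expRD -mulrDl (_ : 1 / 2 + 1 / 2 = 1) ?mul1r ?lnK//; by field.
rewrite wz yz -subr_ge0.
have -> : (1 - z * z) / 2 + (1 - z * z) ^+ 2 / z - (z^-1 - 1) =
   (1 - z) ^+ 2 * z * (3 + 2 * z) / (2 * z) by field; rewrite gt_eqF.
apply: divr_ge0; last by lra.
by apply: mulr_ge0; [apply: mulr_ge0; [exact: sqr_ge0|exact: ltW]|lra].
Qed.

Let integrable_h : mu.-integrable Rpos (EFin \o h).
Proof.
have := integrable_wt_resp2 c_gt1 (lexx 0) ltr01.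
by apply: eq_integrable => // x _; rewrite /= wt0 mul1r.
Qed.

Let weighted_totalB (d : R) : 0 <= d -> d < 1 ->
  weighted_total d + (c + 1)^-1 = \int[mu]_(x in Rpos) ((wt d x - 1) * h x).
Proof.
move=> d0 d1; rewrite -[_^-1]opprK -(weighted_total0 c_gt1) /weighted_total -RintegralB//.
- by apply: eq_Rintegral => x _; rewrite wt0; ring.
- exact: integrable_wt_resp2.
- exact: integrable_wt_resp2.
Qed.

Let integrable_wtB (d : R) : 0 <= d -> d < 1 ->
  mu.-integrable Rpos (EFin \o (fun x => (wt d x - 1) * h x)).
Proof.
move=> d0 d1.
have := integrableB_fun mRpos (integrable_wt_resp2 c_gt1 d0 d1) integrable_h.
by apply: eq_integrable => // x _; rewrite /= wtB1.
Qed.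

Lemma critical_exponent_le (d : R) : 0 <= d -> d < 1 -> weighted_total d = 0 ->
  d / L * (1 - L / (c + 1)) - 64 * d / L ^+ 2 <= (c + 1)^-1.
Proof.
move=> d0 d1 K0; have := weighted_totalB d0 d1; rewrite K0 add0r => e.
rewrite [leRHS]e.
have -> : 64 * d / L ^+ 2 = (32 * d / L ^+ 2) * 2 by field; rewrite gt_eqF.
rewrite -int_mom -int_maj2 -!RintegralZl// -RintegralB//;
  [|exact: integrableZl_fun..].
apply: le_Rintegral => //; last by move=> x /Rpos_gt0; apply: lower_pointwise => //; exact: ltW.
- by apply: integrableB_fun => //; exact: integrableZl_fun.
- exact: integrable_wtB.
Qed.

Lemma critical_exponent_ge (d : R) : 0 <= d -> d <= 1 / 2 -> weighted_total d = 0 ->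
  (c + 1)^-1 <= d / L + 2 * (128 + 4 * (20 / 3) ^+ 5) * d / L ^+ 2.
Proof.
move=> d0 d1 K0; have d11 : d < 1 by lra.
have := weighted_totalB d0 d11; rewrite K0 add0r => e; rewrite [leLHS]e.
have half1 : 1 / 2 < 1 :> R by lra.
have im : mu.-integrable Rpos (EFin \o maj (1 / 2)) by exact: integrable_maj.
have i2 : mu.-integrable Rpos (EFin \o (fun x => 64 * maj2 x + K5 * maj (1 / 2) x)).
  by apply: integrableD_fun => //; exact: integrableZl_fun.
apply: (@le_trans _ _ (\int[mu]_(x in Rpos) (d / L * mom x +
    2 * d / L ^+ 2 * (64 * maj2 x + K5 * maj (1 / 2) x)))).
  apply: le_Rintegral => //; last by move=> x /Rpos_gt0; exact: upper_pointwise.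
  - exact: integrable_wtB.
  - by apply: integrableD_fun => //; exact: integrableZl_fun.
rewrite RintegralD//; [|exact: integrableZl_fun..].
rewrite [X in X + _]RintegralZl// [X in _ + X]RintegralZl//.
rewrite RintegralD//; [|exact: integrableZl_fun..].
rewrite (@RintegralZl _ _ _ mu _ _ 64)// (@RintegralZl _ _ _ mu _ _ K5)//.
rewrite int_mom int_maj2 {1}/Rintegral integral_maj//= /K5.
have dL : 0 <= d / L * (L / (c + 1)).
  by rewrite mulr_ge0// divr_ge0//; clra.
(* Both [maj2] and [maj (1 / 2)] have integral [2], which produces the constants; what remains is
   the dropped term [- L / (c + 1)] of the first moment. *)
rewrite -subr_ge0.
rewrite [leRHS](_ : _ = d / L * (L / (c + 1))) //.
by field; rewrite !gt_eqF//; clra.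
Qed.

(** The two bounds are used in a fixed order: [critical_exponent_le] holds for every [d < 1] and
    forces [r <= 2], hence [d <= 1 / 2], which is what [critical_exponent_ge] requires. The number
    [66] is [64] plus the [2] of [L / (c + 1) <= 2 / L], and [132] is its double, from inverting
    [1 - 66 / L]. *)
Lemma critical_exponent_asymp (d : R) : 0 < d -> d < 1 -> weighted_total d = 0 ->
  132 <= L -> `|d * (c + 1) / L - 1| <= 2 * (194 + 4 * (20 / 3) ^+ 5) / L.
Proof.
move=> d0 d1 K0 L132.
have c10 : 0 < c + 1 by clra.
have Lc : L / (c + 1) <= 2 / L.
  rewrite ler_pdivrMr// mulrAC ler_pdivlMr//.
  have := expR_ge1Dxn 1 (ltW L0); rewrite (_ : 2`!%:R = 2)// expL !expr2; lra.
have i0 : 0 < L^-1 by rewrite invr_gt0.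
have i132 : L^-1 <= 1 / 132 by rewrite div1r lef_pV2 ?posrE.
set r := d * (c + 1) / L.
have r0 : 0 < r by rewrite divr_gt0 ?mulr_gt0.
have hle : r * (1 - 66 / L) <= 1.
  have := critical_exponent_le (ltW d0) d1 K0.
  rewrite -[leRHS]mul1r ler_pdivlMr// => h1.
  apply: le_trans h1.
  rewrite [leRHS](_ : _ = r * (1 - L / (c + 1) - 64 / L)); last first.
    by rewrite /r; field; rewrite !gt_eqF.
  by rewrite ler_pM2l//; lra.
have r2 : r <= 1 + 132 / L.
  have h0 : 0 <= (1 + 132 / L) * (1 - 66 / L) - 1.
    rewrite (_ : _ - 1 = 66 * L^-1 * (1 - 132 * L^-1)); last by field; rewrite gt_eqF.
    by rewrite mulr_ge0//; lra.
  have h66 : 0 < 1 - 66 / L by lra.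
  rewrite -(ler_pM2r h66); lra.
have dhalf : d <= 1 / 2.
  have dE : d = r * (L / (c + 1)) by rewrite /r; field; rewrite !gt_eqF.
  rewrite dE; have Lc0 : 0 <= L / (c + 1) by rewrite divr_ge0 ?ltW.
  have rr : r <= 2 by lra.
  have := ler_pM (ltW r0) Lc0 rr Lc; lra.
have hge : 1 <= r * (1 + 2 * (128 + 4 * (20 / 3) ^+ 5) / L).
  have := critical_exponent_ge (ltW d0) dhalf K0.
  rewrite -[leLHS]mul1r ler_pdivrMr// => h1.
  apply: le_trans h1 _; rewrite le_eqVlt; apply/orP; left; apply/eqP.
  by rewrite /r; field; rewrite !gt_eqF.
move: hge; set K := 2 * (128 + _) => hge.
have Kp : 0 <= K by rewrite /K mulr_ge0// addr_ge0// mulr_ge0// exprn_ge0//; lra.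
have -> : 2 * (194 + 4 * (20 / 3) ^+ 5) = K + 132 by rewrite /K; ring.
have KL : 0 <= K / L by rewrite divr_ge0// ltW.
have rge : 1 - K / L <= r.
  rewrite leNgt; apply/negP => rlt.
  have h1 : r * (1 + K / L) < (1 - K / L) * (1 + K / L) by rewrite ltr_pM2r//; lra.
  have : (1 - K / L) * (1 + K / L) = 1 - (K / L) * (K / L) by ring.
  by have := mulr_ge0 KL KL; lra.
by rewrite ler_norml mulrDl; lra.
Qed.

End CriticalExponentAsymptotics.

(** * The sign alternative and the phase transition for the Pareto law *)

Section ParetoPotts.
Variables (R : realType) (tau : R) (q : nat).
Hypotheses (tau_gt3 : 3 < tau) (q_ge3 : (3 <= q)%N).
Variables (d : measure_display) (T : measurableType d) (P : probability T R).
Variables (W : {RV P >-> R}).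
Hypothesis hW : has_density W (pareto_pdf tau).
Local Notation mu := (@lebesgue_measure R).
Local Notation D := (`[1%R, +oo[%classic : set R).
Local Notation c := (q%:R - 1 : R).

Let c_gt1 : 1 < c.
Proof.
have : 3 <= q%:R :> R by rewrite ler_nat.
lra.
Qed.

Let tau1 : 1 < tau. Proof. by move: tau_gt3; lra. Qed.

Let cE : c + 1 = q%:R. Proof. by rewrite subrK. Qed.

Let M0 := pareto_mean_gt0 tau_gt3.

Lemma expect_paretoE : expect P W = pareto_mean tau.
Proof. exact: (@expect_pareto R tau tau1 _ _ P W id hW). Qed.

Lemma nu_paretoE : nu W = pareto_sqmean tau / pareto_mean tau.
Proof.
rewrite /nu expect_paretoE; congr (_ / _).
apply: (@expect_pareto R tau tau1 _ _ P W (fun w => w ^+ 2) hW).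
exact: measurable_funX.
Qed.

Lemma F0_paretoE : F0 W q = pareto_F tau c.
Proof.
apply/funext => t; rewrite /F0 /pareto_F expect_paretoE.
pose k (w : R) := (pareto_mean tau)^-1 * (w ^+ 1 * resp c (t * w)).
have mr : measurable_fun setT (fun w : R => resp c (t * w)).
  apply: continuous_measurable_fun => w.
  have hm := is_derive_funM (is_derive_fun_cst t w) (is_derive_fun_id w).
  exact: is_derive_continuous (is_derive_fun_comp hm (is_derive_resp c_gt1 (t * w))).
have mk : measurable_fun setT k.
  by apply: measurable_funM => //; apply: measurable_funM => //; exact: measurable_funX.
have -> : (fun x => W x / pareto_mean tau *
    ((expR (t * W x) - 1) / (expR (t * W x) + q%:R - 1))) = (fun x => k (W x)).
  by apply/funext => x; rewrite /k /resp addrA expr1; ring.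
rewrite (@expect_pareto R tau tau1 _ _ P W k hW mk).
rewrite -RintegralZl//.
  by apply: eq_Rintegral => w _; rewrite /k mulrA.
apply: (@integrable_pareto_scaled R tau tau_gt3 (resp c) 1 1).
  by move=> y; exact: continuous_resp.
move=> w w1; rewrite normrM expr1 mul1r ger0_norm; last by lra.
have := norm_resp_le c_gt1 (t * w); have := normr_ge0 (resp c (t * w)).
by rewrite expr2; nra.
Qed.

(** The term of [p0] linear in [s] is exactly the affine part that [pareto_Phi] subtracts from
    [pareto_lnmean], so only the quadratic penalty survives, up to a term depending on [b] alone. *)
Lemma p0_paretoE (b s : R) : p0 W q b s =
  pareto_lnmean tau c 0 + (expR b - 1) * pareto_mean tau / (2 * q%:R) +
  pareto_mean tau * c / q%:R *
    (pareto_Phi tau c ((expR b - 1) * s) - (expR b - 1) * s ^+ 2 / 2).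
Proof.
rewrite /p0 expect_paretoE.
have -> : expect P (fun x => ln (expR ((expR b - 1) * W x * s) + q%:R - 1)) =
    pareto_lnmean tau c ((expR b - 1) * s).
  pose k (w : R) := w ^+ 0 * ln (expR ((expR b - 1) * s * w) + c).
  have mk : measurable_fun setT k.
    apply: continuous_measurable_fun => w.
    have hm := is_derive_funM (is_derive_fun_cst ((expR b - 1) * s) w) (is_derive_fun_id w).
    have hd := is_derive_fun_comp hm (is_derive_ln_den c_gt1 ((expR b - 1) * s * w)).
    by apply: cvgM; [exact: cvg_cst|exact: is_derive_continuous hd].
  rewrite /pareto_lnmean -(@expect_pareto R tau tau1 _ _ P W k hW mk); congr expect.
  apply/funext => x; rewrite /k expr0 mul1r addrA.
  by rewrite mulrAC.
rewrite /pareto_Phi; move: c_gt1 M0 (esym cE).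
move: (pareto_mean tau) (pareto_lnmean tau c 0) (pareto_lnmean tau c _) => M l0 l; move: (c) => a a1 M_gt0 ->.
field.
by rewrite !gt_eqF//; lra.
Qed.

Lemma pareto_ddF_weighted_tail (t : R) : 0 < t -> exists2 k : R, 0 < k &
  pareto_ddF tau c t = k * weighted_tail c (tau - 3) t.
Proof.
move=> t0; have t3 := tau_gt3; have M := M0.
exists ((pareto_mean tau)^-1 * (tau - 1) * t `^ (tau - 4) * ln c `^ (- (tau - 3))).
  by rewrite !mulr_gt0 ?invr_gt0 ?powR_gt0 ?lnc_gt0//; lra.
rewrite (pareto_ddFE tau_gt3 c_gt1 t0).
have t30 : 0 <= tau - 3 by lra.
have -> : \int[mu]_(x in `[t, +oo[) (x `^ (3 - tau) * resp2 c x) =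
    ln c `^ (- (tau - 3)) * weighted_tail c (tau - 3) t.
  rewrite /weighted_tail -RintegralZl//; last exact: integrable_wt_resp2_tail.
  apply: eq_Rintegral => x; rewrite inE/= in_itv/= andbT => tx.
  rewrite mulrA -(wt_powR c_gt1)//; last exact: lt_le_trans tx.
  by rewrite opprB.
by rewrite [LHS]mulrA.
Qed.

Lemma derive1_F0 : derive1 (F0 W q) = pareto_dF tau c.
Proof.
rewrite F0_paretoE; apply/funext => t; rewrite derive1E.
exact: (@derive_val _ _ _ _ _ _ _ (is_derive_pareto_F tau_gt3 c_gt1 t)).
Qed.

Lemma derive2_F0 (t : R) : 0 < t -> derive1n 2 (F0 W q) t = pareto_ddF tau c t.
Proof.
move=> t0; rewrite derive1nS derive1n1 derive1_F0 derive1E.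
exact: (@derive_val _ _ _ _ _ _ _ (is_derive_pareto_dF tau_gt3 c_gt1 t0)).
Qed.

Lemma twice_derivable_F0 : twice_derivable_pos (F0 W q).
Proof.
move=> t t0; rewrite derive1_F0 F0_paretoE; split.
  by have [] := is_derive_pareto_F tau_gt3 c_gt1 t.
by have [] := is_derive_pareto_dF tau_gt3 c_gt1 t0.
Qed.

Let C1_gt0 (b : R) : 0 < b -> 0 < pareto_mean tau * c / q%:R.
Proof.
move=> _; have q0 : 0 < q%:R :> R by have := c_gt1; lra.
by rewrite divr_gt0// mulr_gt0 ?M0//; have := c_gt1; lra.
Qed.

Variable ds : R.
Hypotheses (ds0 : 0 < ds) (ds1 : ds < 1) (weighted_total_ds : weighted_total c ds = 0).

Let supercritical : 3 + ds < tau -> exists ts : R, [/\ 0 < ts,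
  forall t, 0 < t -> t < ts -> 0 < pareto_ddF tau c t &
  forall t, ts < t -> pareto_ddF tau c t < 0].
Proof.
move=> h; have dsd : ds < tau - 3 by lra.
have [ts [ts0 h1 h2]] := weighted_tail_sign_change c_gt1 (ltW ds0) ds1 dsd weighted_total_ds.
exists ts; split=> // t.
  move=> t0 tts; have [k k0 ->] := pareto_ddF_weighted_tail t0.
  by rewrite mulr_gt0// h1.
move=> tst; have [k k0 ->] := pareto_ddF_weighted_tail (lt_trans ts0 tst).
by rewrite pmulr_rlt0// h2.
Qed.

Let subcritical : tau <= 3 + ds -> forall t, 0 < t -> pareto_ddF tau c t < 0.
Proof.
move=> h t t0; have [k k0 ->] := pareto_ddF_weighted_tail t0; rewrite pmulr_rlt0//.
have t3 := tau_gt3.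
have dds : tau - 3 <= ds by lra.
apply: weighted_tail_lt0 => //; [lra|exact: le_lt_trans ds1|].
by rewrite -weighted_total_ds; apply: weighted_total_homo => //; lra.
Qed.

Lemma supercritical_sign : 3 + ds < tau ->
  first_positive_then_negative (derive1n 2 (F0 W q)).
Proof.
move=> /supercritical[ts [ts0 h1 h2]]; exists ts; split=> // t.
  by move=> t0 tts; rewrite derive2_F0// h1.
by move=> tst; rewrite derive2_F0 ?h2//; exact: lt_trans tst.
Qed.

Lemma subcritical_sign : tau <= 3 + ds -> negative_on_pos (derive1n 2 (F0 W q)).
Proof. by move=> h t t0; rewrite derive2_F0// subcritical. Qed.

Lemma supercritical_first_order : 3 + ds < tau -> first_order (p0 W q).
Proof.
move=> /supercritical[ts [ts0 h1 h2]].
apply: (@convex_concave_first_order R _ _ _ _ (pareto_Phi tau c) _ _ (is_derive_pareto_Phi tau_gt3 c_gt1)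
  (is_derive_pareto_F tau_gt3 c_gt1) (fun t t0 => is_derive_pareto_dF tau_gt3 c_gt1 t0) (pareto_Phi0 _ _)
  (pareto_F_0 _ _) (pareto_F_gt0 tau_gt3 c_gt1) (fun t _ => pareto_F_lt1 tau_gt3 c_gt1 t)
  C1_gt0 p0_paretoE ts ts0 h1 h2).
Qed.

(** The critical ratio is [F_0'(0) = nu / q], because [resp1 c 0 = 1 / q]. *)
Lemma subcritical_second_order : tau <= 3 + ds ->
  second_order (p0 W q) (ln (1 + q%:R / nu W)).
Proof.
move=> h; have dF0 := pareto_dF_0 tau_gt3 c_gt1.
have S0 := pareto_sqmean_gt0 tau_gt3; have c1 := c_gt1.
rewrite nu_paretoE (_ : q%:R / _ = (pareto_dF tau c 0)^-1); last first.
  by rewrite dF0 cE [RHS]invf_div.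
apply: (@concave_second_order R _ _ _ _ (pareto_Phi tau c) _ _ (is_derive_pareto_Phi tau_gt3 c_gt1)
  (is_derive_pareto_F tau_gt3 c_gt1) (fun t t0 => is_derive_pareto_dF tau_gt3 c_gt1 t0) (pareto_Phi0 _ _)
  (pareto_F_0 _ _) (fun t _ => pareto_F_lt1 tau_gt3 c_gt1 t)
  C1_gt0 p0_paretoE).
- by rewrite dF0 !divr_gt0//; lra.
- exact: subcritical.
Qed.

End ParetoPotts.

(** * The equation and the asymptotics of the critical exponent in terms of [q] *)

Section CriticalTau.
Variable R : realType.
Local Notation mu := (@lebesgue_measure R).

Lemma critical_integral (c ds : R) : 1 < c -> 0 < ds -> ds < 1 -> weighted_total c ds = 0 ->
  (\int[mu]_(x in (`]0%R, +oo[%classic : set R))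
    (x `^ (3 - (3 + ds)) *
      ((c * expR x - expR (2 * x)) / (expR x + c) ^+ 3))%:E = 0)%E.
Proof.
move=> c1 ds0 ds1 K0.
have intf := integrable_wt_resp2 c1 (ltW ds0) ds1.
transitivity (\int[mu]_(x in (`]0%R, +oo[%classic : set R))
   ((ln c `^ (- ds) / (c + 1))%:E * (wt c ds x * resp2 c x)%:E))%E.
  apply: eq_integral => x; rewrite inE/= in_itv/= andbT => x0.
  rewrite -EFinM; congr EFin.
  have -> : 3 - (3 + ds) = - ds by ring.
  rewrite (wt_powR c1 ds x0) /resp2.
  have -> : expR (2 * x) = expR x * expR x by rewrite -expRD; congr expR; ring.
  by field; rewrite !gt_eqF//; have := expR_gt0 x; lra.
rewrite integralZl//.
have -> : (\int[mu]_(x in (`]0%R, +oo[%classic : set R)) (wt c ds x * resp2 c x)%:E =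
    (weighted_total c ds)%:E)%E.
  by rewrite /weighted_total /Rintegral fineK//; exact: integrable_fin_num.
by rewrite K0 mule0.
Qed.

Lemma critical_tau_asymp (ds : nat -> R) :
  (forall q, (3 <= q)%N -> [/\ 0 < ds q, ds q < 1 & weighted_total (q%:R - 1 : R) (ds q) = 0]) ->
  (ds q * q%:R / ln q%:R - 1) @[q --> \oo] --> (0 : R).
Proof.
move=> hds; pose K : R := 2 * (194 + 4 * (20 / 3) ^+ 5) + 1.
have K0 : 0 < K.
  by rewrite addr_gt0// mulr_gt0// addr_gt0// mulr_gt0// exprn_gt0//; lra.
apply/cvgr0Pnorm_lt => e e0.
near=> q.
have q3 : (3 <= q)%N by near: q; exact: nbhs_infty_ge.
have [d0 d1 dK] := hds q q3.
pose c : R := q%:R - 1.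
have c1 : 1 < c.
  have : 3 <= q%:R :> R by rewrite ler_nat.
  rewrite /c; lra.
have cq : c + 1 = q%:R by rewrite subrK.
(* The first exponential secures [132 <= ln c], the second [K / ln c < e]. *)
pose B : R := expR 132 + expR (K / e + 1) + 1.
have Bq : B <= q%:R by near: q; exact: nbhs_infty_ger.
have exp0 (x : R) : 0 < expR x by exact: expR_gt0.
have lnB (x : R) : expR x <= c -> x <= ln c.
  by move=> h; rewrite -[leLHS]expRK ler_ln ?posrE//; lra.
have L132 : 132 <= ln c by apply: lnB; have := exp0 (K / e + 1); rewrite /B in Bq; lra.
have LK : K / e + 1 <= ln c by apply: lnB; have := exp0 132; rewrite /B in Bq; lra.
have := critical_exponent_asymp c1 d0 d1 dK L132; rewrite cq.
have Lp : 0 < ln c by lra.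
have Lq : ln c < ln (q%:R : R) by rewrite ltr_ln ?posrE -?cq; lra.
have Lqc : ln (q%:R : R) <= ln c + 1.
  have -> : (q%:R : R) = c * (1 + c^-1) by rewrite -cq; field; rewrite gt_eqF//; lra.
  have cV : 0 < c^-1 by rewrite invr_gt0; lra.
  rewrite lnM ?posrE//; [|lra|lra].
  rewrite lerD2l; apply: (@le_trans _ _ c^-1); first by apply: le_ln1Dx; lra.
  by rewrite invf_le1; lra.
set r := ds q * q%:R / ln c => hr.
(* The estimate is in terms of [ln (q - 1)]; [rho] converts it to [ln q] with an error at most
   [1 / ln c], for which [K] contains the summand [1]. *)
pose rho := ln c / ln (q%:R : R).
have lq0 : 0 < ln (q%:R : R) by lra.
have rho0 : 0 < rho by rewrite divr_gt0.
have rho1 : rho <= 1 by rewrite ler_pdivrMr// mul1r ltW.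
have rho2 : 1 - rho <= (ln c)^-1.
  have -> : 1 - rho = (ln (q%:R : R) - ln c) / ln (q%:R : R).
    by rewrite /rho; field; rewrite gt_eqF.
  apply: (@le_trans _ _ (1 / ln (q%:R : R))).
    by rewrite ler_pM2r ?invr_gt0//; lra.
  by rewrite div1r lef_pV2 ?posrE// ltW.
have -> : ds q * q%:R / ln q%:R - 1 = (r - 1) * rho - (1 - rho).
  by rewrite /r /rho; field; rewrite !gt_eqF.
apply: le_lt_trans (ler_normB _ _) _.
rewrite normrM (ger0_norm (ltW rho0)) [`|1 - rho|]ger0_norm; last by lra.
apply: (@le_lt_trans _ _ (K / ln c)).
  have -> : K / ln c = (K - 1) / ln c + (ln c)^-1 by field; rewrite gt_eqF.
  have KE : K - 1 = 2 * (194 + 4 * (20 / 3) ^+ 5) by rewrite /K addrK.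
  rewrite KE; apply: lerD => //.
  by apply: le_trans hr; rewrite ler_piMr.
rewrite ltr_pdivrMr// -ltr_pdivrMl//; move: LK; rewrite mulrC; lra.
Unshelve. all: by end_near. Qed.

End CriticalTau.

Theorem theorem1p23 (R : realType) :
  exists tauc : nat -> R,
    (forall q : nat, (3 <= q)%N ->
      [/\ 3 < tauc q /\ tauc q <= 4,
          (forall (tau : R) (d : measure_display) (T : measurableType d)
                  (P : probability T R) (W : {RV P >-> R}),
             3 < tau -> tau <= 4 -> has_density W (pareto_pdf tau) ->
             [/\ twice_derivable_pos (F0 W q),
                 tauc q < tau ->
                   first_positive_then_negative (derive1n 2 (F0 W q)),
                 tau <= tauc q -> negative_on_pos (derive1n 2 (F0 W q)),
                 tauc q < tau -> first_order (p0 W q) &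
                 tau <= tauc q ->
                   second_order (p0 W q) (ln (1 + q%:R / nu W))]) &
          (* an extended real equality: in particular the integral converges *)
          (\int[lebesgue_measure]_(x in (`]0%R, +oo[%classic : set R))
             (x `^ (3 - tauc q) *
              (((q%:R - 1) * expR x - expR (2 * x))
                 / (expR x + q%:R - 1) ^+ 3))%:E = 0)%E]) /\
    (exists eps : nat -> R,
       eps q @[q --> \oo] --> 0 /\
       forall q : nat, (3 <= q)%N ->
         tauc q = 3 + ln q%:R / q%:R * (1 + eps q)).
Proof.
have c_gt1 (q : nat) : (3 <= q)%N -> 1 < q%:R - 1 :> R.
  move=> q3; have : 3 <= q%:R :> R by rewrite ler_nat.
  lra.
have /choice[ds hds] : forall q : nat, exists ds : R,
    (3 <= q)%N -> [/\ 0 < ds, ds < 1 & weighted_total (q%:R - 1 : R) ds = 0].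
  (* The value [0] for [q < 3] is a filler that makes [ds] a total function. *)
  move=> q; have [q3|] := boolP (3 <= q)%N; last by exists 0.
  by have [ds h] := weighted_total_zero (c_gt1 q q3); exists ds.
exists (fun q => 3 + ds q); split.
  move=> q q3; have [d0 d1 dK] := hds q q3; split.
  - by split; lra.
  - move=> tau d T P W tau3 tau4 hW; split.
    + exact: (@twice_derivable_F0 R tau q tau3 q3 d T P W hW).
    + exact: (@supercritical_sign R tau q tau3 q3 d T P W hW (ds q) d0 d1 dK).
    + exact: (@subcritical_sign R tau q tau3 q3 d T P W hW (ds q) d1 dK).
    + exact: (@supercritical_first_order R tau q tau3 q3 d T P W hW (ds q) d0 d1 dK).
    + exact: (@subcritical_second_order R tau q tau3 q3 d T P W hW (ds q) d1 dK).
  - rewrite -[RHS](critical_integral (c_gt1 q q3) d0 d1 dK).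
    by apply: eq_integral => x _; rewrite addrA.
(* The error term is defined by solving the expansion for it; only its convergence has content. *)
exists (fun q => ds q * q%:R / ln q%:R - 1); split; first exact: critical_tau_asymp.
move=> q q3; have q1 : 1 < q%:R :> R by have := c_gt1 q q3; lra.
have lq : 0 < ln (q%:R : R) by exact: ln_gt0.
by field; rewrite !gt_eqF//; lra.
Qed.
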